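(* $$\gamma_1\left(\tfrac34\right)=\tfrac12\left[2\gamma_1-7\log^2 2-6\gamma\log 2\right]+\tfrac12\pi\left[\gamma+4\log 2+3\log\pi-4\log\Gamma\left(\tfrac14\right)\right].$$
   Context: For real $u>0$, $\zeta(s,u)$ is the Hurwitz zeta function (the meromorphic continuation in $s$ of $\sum_{n\ge 0}(n+u)^{-s}$). The generalised Stieltjes constants $\gamma_p(u)$, $p\ge 0$, are defined by the Laurent expansion about $s=1$: $\zeta(s,u)=\frac{1}{s-1}+\sum_{p=0}^\infty\frac{(-1)^p}{p!}\gamma_p(u)(s-1)^p$, and $\gamma_p=\gamma_p(1)$. $\gamma$ (no subscript) is Euler's constant, $\Gamma$ the gamma function and $\log$ the natural logarithm. *)

(* Defs.v *)
From Stdlib Require Import Reals Factorial.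
From Coquelicot Require Import Coquelicot.
Open Scope R_scope.

(* x^s for real x > 0 and complex s, i.e. exp (s log x) with the real
   logarithm of x. *)
Definition RpowC (x : R) (s : C) : C :=
  (RtoC (Rpower x (Re s)) * (cos (Im s * ln x), sin (Im s * ln x)))%C.

(* [zeta s u] is the Hurwitz zeta function.  By the identity theorem the two
   conditions determine [fun s => zeta s u] on C \ {1}; its value at the pole
   s = 1 is left unconstrained. *)
Definition is_hurwitz_zeta (zeta : C -> R -> C) : Prop :=
  forall u : R, 0 < u ->
    (forall s : C, s <> RtoC 1 ->
       ex_derive (K := C_AbsRing) (V := C_NormedModule)
         (fun z : C => zeta z u) s) /\
    (forall s : C, 1 < Re s ->
       is_series (K := C_AbsRing) (V := C_NormedModule)
         (fun n : nat => RpowC (INR n + u) (- s)%C) (zeta s u)).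

(* [g p u] is the generalised Stieltjes constant gamma_p(u): the Laurent
   expansion of [zeta] holds in a punctured neighbourhood of s = 1. *)
Definition is_stieltjes (zeta : C -> R -> C) (g : nat -> R -> R) : Prop :=
  forall u : R, 0 < u ->
    locally' (T := C_UniformSpace) (RtoC 1) (fun s : C =>
      is_series (K := C_AbsRing) (V := C_NormedModule)
        (fun p : nat =>
           (RtoC ((-1) ^ p / INR (fact p) * g p u) * (s - RtoC 1) ^ p)%C)
        (zeta s u - / (s - RtoC 1))%C).

(* H_N - log N with N = n + 1, so that the logarithm is never taken at 0. *)
Definition euler_gamma : R :=
  real (Lim_seq (fun n : nat =>
    sum_n (fun k : nat => / INR (S k)) n - ln (INR (S n)))).

(* Euler's integral, meaningful for x > 0. *)
Definition Gamma (x : R) : R :=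
  RInt_gen (fun t : R => Rpower t (x - 1) * exp (- t))
    (at_right 0) (Rbar_locally p_infty).

(* Main.v *)
Require Import Defs.
From Stdlib Require Import Reals Factorial Lra Lia Psatz Ratan Classical_Prop.
From Coquelicot Require Import Coquelicot.
Open Scope R_scope.

(** Put [Z u e] for the sum of the [(n + u)^(-1-e)], so that
    [Z u e - 1/e = gamma_0(u) - gamma_1(u) e + O(e^2)] as [e] decreases to 0. The identity
    [Z (1/4) + Z (3/4) = (4^(1+e) - 2^(1+e)) Z 1], expanded to first order, gives
    [gamma_1(1/4) + gamma_1(3/4)]; differentiating [Z (1/4) - Z (3/4)] at [e = 0]
    reduces [gamma_1(1/4) - gamma_1(3/4)] to Malmsten's series
    [S = sum (-1)^k ln (2k+1) / (2k+1)].

    To evaluate [S], let [Cin z] be the integral of [(1 - cos y) / y] over [[0, z]], so that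
    [Cin z = ln z + gamma + O(1/z)]. The partial sums of
    [sum (-1)^k (1 - cos ((2k+1) y)) / (2k+1)] converge boundedly to a square wave with values
    [0] and [pi/2]. Dividing by [y] and integrating up to [Y = (2K + 1/2) pi], once term by term
    and once through the limit, gives
    [S + pi/4 (ln Y + gamma) + O(1/Y) = pi/2 sum_(i<K) ln ((i + 3/4) / (i + 1/4))].
    The product on the right is asymptotically known from Wallis' formula and from
    [Gamma (n + 1/4)] being squeezed between factorials by log-convexity. *)

(** * Derivative bounds, finite sums, Wallis products *)

(** Why the cosine integral: substituting [a y] shows that the integral of [(1 - cos (a y)) / y]
    over [[0, Y]] is [Cin (a Y)], that is [ln a + ln Y + gamma] up to [O(1 / (a Y))]. With
    [a = 2k+1] and weights [(-1)^k / (2k+1)] the terms [ln a] add up to Malmsten's series, and the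
    errors are summable in [k]. Euler's constant enters [Cin] through the odd harmonic numbers,
    which a Dirichlet kernel relates to [Cin (PI N)]. The obstacle is that [S] converges only
    conditionally, so every exchange of limits needs an error bound uniform in one of the indices.
    [Y] grows only after the number of terms has, and in the zeta part [e] tends to [0] with a fixed
    cutoff [N]. Such bounds come from comparing derivatives: a primitive is corrected by its
    oscillating boundary term, and [incr_bound] controls what remains. The point [3/4] leaves no
    trace in the Gamma values because the product of the [(i + 1/4) (i + 3/4)] is a Wallis
    product. *)

Lemma incr_bound (f g df dg : R -> R) (a b : R) :
  a <= b ->
  (forall x, a <= x <= b -> is_derive f x (df x)) ->
  (forall x, a <= x <= b -> is_derive g x (dg x)) ->
  (forall x, a <= x <= b -> Rabs (df x) <= dg x) ->
  Rabs (f b - f a) <= g b - g a.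
Proof.
intros Hab Hf Hg Hd.
assert (H : forall s : R, Rabs s = 1 -> s * (f b - f a) <= g b - g a).
{ intros s Hs.
  destruct (MVT_gen (fun x => g x - s * f x) a b (fun x => dg x - s * df x))
    as [c [Hc E]]; rewrite ?Rmin_left, ?Rmax_right in * by lra.
  - intros x Hx. apply (is_derive_minus g (fun x => s * f x)).
    + apply Hg; lra.
    + apply (is_derive_scal f). apply Hf; lra.
  - intros x Hx. apply continuity_pt_filterlim.
    apply (ex_derive_continuous (fun x => g x - s * f x)).
    eexists. apply (is_derive_minus g (fun x => s * f x)).
    + apply Hg; lra.
    + apply (is_derive_scal f). apply Hf; lra.
  - assert (s * df c <= dg c).
    { apply Rle_trans with (2 := Hd c Hc). apply Rle_trans with (1 := Rle_abs _).
      rewrite Rabs_mult, Hs; lra. }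
    assert (0 <= (dg c - s * df c) * (b - a)) by (apply Rmult_le_pos; lra).
    lra. }
apply Rabs_le; split.
- assert (E := H (-1)). rewrite (Rabs_left (-1)) in E by lra. lra.
- assert (E := H 1 Rabs_R1). lra.
Qed.

Lemma lipschitz_bound (f df : R -> R) (C a b : R) :
  a <= b ->
  (forall x, a <= x <= b -> is_derive f x (df x)) ->
  (forall x, a <= x <= b -> Rabs (df x) <= C) ->
  Rabs (f b - f a) <= C * (b - a).
Proof.
intros Hab Hf Hd.
replace (C * (b - a)) with (C * b - C * a) by ring.
apply (incr_bound f (fun x => C * x) df (fun _ => C)); auto.
intros; auto_derive; auto; ring.
Qed.

Lemma is_derive_Rdiv (f : R -> R) (c x l : R) :
  is_derive f x l -> is_derive (fun y => f y / c) x (l / c).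
Proof.
intros H. unfold Rdiv. rewrite Rmult_comm.
apply (is_derive_ext (fun y => / c * f y)); [intros; apply Rmult_comm|].
now apply (is_derive_scal f).
Qed.

Fixpoint psum (f : nat -> R) (n : nat) : R :=
  match n with O => 0 | S k => psum f k + f k end.

Lemma psum_sum_n f n : sum_n f n = psum f (S n).
Proof.
induction n; [rewrite sum_O; simpl; now rewrite Rplus_0_l|].
rewrite sum_Sn, IHn. reflexivity.
Qed.

Lemma psum_ext f g n :
  (forall k, (k < n)%nat -> f k = g k) -> psum f n = psum g n.
Proof.
induction n; intros H; simpl; auto. rewrite IHn, H; auto.
Qed.

Lemma psum_eq0 f n : (forall k, (k < n)%nat -> f k = 0) -> psum f n = 0.
Proof.
induction n; intros H; simpl; auto. rewrite IHn, H; auto; ring.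
Qed.

Lemma psum_minus f g n : psum (fun k => f k - g k) n = psum f n - psum g n.
Proof. induction n; simpl; rewrite ?IHn; ring. Qed.

Lemma psum_scal c f n : psum (fun k => c * f k) n = c * psum f n.
Proof. induction n; simpl; rewrite ?IHn; ring. Qed.

Lemma psum_le f g n :
  (forall k, (k < n)%nat -> f k <= g k) -> psum f n <= psum g n.
Proof.
induction n; intros H; simpl; [lra|].
apply Rplus_le_compat; auto.
Qed.

Lemma psum_abs f n : Rabs (psum f n) <= psum (fun k => Rabs (f k)) n.
Proof.
induction n; simpl; [rewrite Rabs_R0; lra|].
apply Rle_trans with (1 := Rabs_triang _ _). lra.
Qed.

Lemma is_derive_psum (f df : nat -> R -> R) x n :
  (forall k, is_derive (f k) x (df k x)) ->
  is_derive (fun y => psum (fun k => f k y) n) x (psum (fun k => df k x) n).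
Proof.
intros H; induction n; simpl.
- apply (is_derive_const 0).
- apply (is_derive_plus (fun y => psum (fun k => f k y) n) (f n)); auto.
Qed.

Lemma is_lim_seq_sandwich (u v : nat -> R) l :
  is_lim_seq v 0 -> eventually (fun n => Rabs (u n - l) <= v n) ->
  is_lim_seq u l.
Proof.
intros Hv H.
apply is_lim_seq_ext with (fun n => l + (u n - l)); [intros; ring|].
replace (Finite l) with (Rbar_plus l 0) by (simpl; f_equal; ring).
apply is_lim_seq_plus with l 0; [apply is_lim_seq_const| |reflexivity].
apply is_lim_seq_abs_0.
apply is_lim_seq_le_le_loc with (fun _ => 0) v; auto.
- destruct H as [N H]; exists N; intros n Hn; split; auto. apply Rabs_pos.
- apply is_lim_seq_const.
Qed.

Lemma is_lim_seq_inv_INR : is_lim_seq (fun n => / INR n) 0.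
Proof.
replace (Finite 0) with (Rbar_inv p_infty) by reflexivity.
apply is_lim_seq_inv; [apply is_lim_seq_INR|discriminate].
Qed.

(** The shape of a bounded convergence argument: short exceptional intervals of length [d]
    contribute at most a multiple of [d], and off them there is decay like [1 / n] with a constant
    that may blow up as [d] shrinks. *)
Lemma is_lim_seq_0_eps (u : nat -> R) :
  (forall d, 0 < d <= 1 / 2 -> exists C, forall n, (0 < n)%nat ->
     Rabs (u n) <= 4 * d + C / INR n) ->
  is_lim_seq u 0.
Proof.
intros H. apply is_lim_seq_spec. intros eps.
assert (He := cond_pos eps). set (d := Rmin (1 / 2) (eps / 8)).
assert (Hd : 0 < d <= 1 / 2) by (split; [apply Rmin_pos; lra|apply Rmin_l]).
assert (Hd' : d <= eps / 8) by apply Rmin_r.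
destruct (H d Hd) as [C HC].
assert (HCl : is_lim_seq (fun n => C / INR n) 0).
{ replace (Finite 0) with (Rbar_mult C 0) by (simpl; f_equal; ring).
  apply (is_lim_seq_scal_l (fun n => / INR n) C 0), is_lim_seq_inv_INR. }
apply is_lim_seq_spec in HCl.
assert (He2 : 0 < eps / 2) by lra.
destruct (HCl (mkposreal _ He2)) as [M HM]. simpl in HM.
exists (S M). intros n Hn. specialize (HC n ltac:(lia)). specialize (HM n ltac:(lia)).
rewrite Rminus_0_r in *. apply Rabs_def2 in HM. lra.
Qed.

Definition wallis (n : nat) : R := RInt (fun x => cos x ^ n) 0 (PI / 2).

Lemma continuous_cos_pow n x : continuous (fun x => cos x ^ n) x.
Proof.
apply (ex_derive_continuous (fun x => cos x ^ n)). auto_derive. auto.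
Qed.

Lemma ex_RInt_cos_pow n a b : ex_RInt (fun x => cos x ^ n) a b.
Proof.
apply (ex_RInt_continuous (V := R_CompleteNormedModule)).
intros; apply continuous_cos_pow.
Qed.

(** The integrand on the left minus that on the right is the derivative of
    [cos x ^ (n + 1) * sin x], which vanishes at both ends. *)
Lemma wallis_rec n : INR (n + 2) * wallis (n + 2) = INR (n + 1) * wallis n.
Proof.
assert (HI : is_RInt (fun x => INR (n + 2) * cos x ^ (n + 2) - INR (n + 1) * cos x ^ n)
         0 (PI / 2) (cos (PI / 2) ^ (n + 1) * sin (PI / 2) - cos 0 ^ (n + 1) * sin 0)).
{ apply (is_RInt_derive (fun x => cos x ^ (n + 1) * sin x)).
  - intros x _. auto_derive; auto.
    rewrite plus_INR. simpl INR.
    replace (Init.Nat.pred (n + 1)) with n by lia.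
    replace (n + 2)%nat with (S (S n)) by lia.
    replace (n + 1)%nat with (S n) by lia.
    simpl pow.
    assert (E := sin2_cos2 x). unfold Rsqr in E.
    transitivity (- (INR n + 1) * cos x ^ n * (sin x * sin x) + cos x * cos x ^ n * cos x);
      [ring|].
    replace (sin x * sin x) with (1 - cos x * cos x) by lra. rewrite ?S_INR. ring.
  - intros x _. apply (ex_derive_continuous (fun x => INR (n + 2) * cos x ^ (n + 2) - INR (n + 1) * cos x ^ n)).
    auto_derive. auto. }
assert (HJ : is_RInt (fun x => INR (n + 2) * cos x ^ (n + 2) - INR (n + 1) * cos x ^ n)
         0 (PI / 2) (INR (n + 2) * wallis (n + 2) - INR (n + 1) * wallis n)).
{ apply (is_RInt_minus (fun x => INR (n + 2) * cos x ^ (n + 2)) (fun x => INR (n + 1) * cos x ^ n)).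
  - apply (is_RInt_scal (fun x => cos x ^ (n + 2))).
    apply (RInt_correct (V := R_CompleteNormedModule)), ex_RInt_cos_pow.
  - apply (is_RInt_scal (fun x => cos x ^ n)).
    apply (RInt_correct (V := R_CompleteNormedModule)), ex_RInt_cos_pow. }
assert (E := eq_trans (eq_sym (is_RInt_unique _ _ _ _ HI)) (is_RInt_unique _ _ _ _ HJ)).
rewrite cos_PI2, sin_0, pow_add in E. simpl in E. lra.
Qed.

Lemma wallis_decr n : wallis (S n) <= wallis n.
Proof.
assert (HP := PI_RGT_0).
apply RInt_le; try apply ex_RInt_cos_pow; [lra|].
intros x Hx. assert (0 <= cos x) by (apply cos_ge_0; lra).
assert (E := COS_bound x). simpl.
assert (0 <= cos x ^ n) by (apply pow_le; auto). nra.
Qed.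

Lemma wallis_0 : wallis 0 = PI / 2.
Proof.
unfold wallis. simpl. rewrite RInt_const. unfold scal; simpl; unfold mult; simpl. lra.
Qed.

Lemma wallis_1 : wallis 1 = 1.
Proof.
unfold wallis. apply is_RInt_unique.
apply is_RInt_ext with cos; [intros; simpl; ring|].
replace 1 with (sin (PI / 2) - sin 0) by (rewrite sin_PI2, sin_0; ring).
apply (is_RInt_derive sin).
- intros; auto_derive; auto; ring.
- intros; apply continuous_cos.
Qed.

(** This is the central binomial coefficient of [2n] divided by [4^n]. *)
Fixpoint odd_even_prod (n : nat) : R :=
  match n with
  | O => 1
  | S k => odd_even_prod k * (INR (2 * k + 1) / INR (2 * k + 2))
  end.

Lemma odd_even_prod_pos n : 0 < odd_even_prod n.
Proof.
induction n; [simpl; lra|]. cbn [odd_even_prod].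
apply Rmult_lt_0_compat; auto. apply Rdiv_lt_0_compat; apply lt_0_INR; lia.
Qed.

Lemma wallis_even n : wallis (2 * n) = PI / 2 * odd_even_prod n.
Proof.
induction n; [simpl; rewrite wallis_0; ring|].
assert (E := wallis_rec (2 * n)). rewrite IHn in E.
replace (2 * S n)%nat with (2 * n + 2)%nat by lia. cbn [odd_even_prod].
assert (0 < INR (2 * n + 2)) by (apply lt_0_INR; lia).
apply Rmult_eq_reg_l with (INR (2 * n + 2)); [|lra]. rewrite E. field. lra.
Qed.

Lemma wallis_odd n : wallis (2 * n + 1) * (INR (2 * n + 1) * odd_even_prod n) = 1.
Proof.
induction n; [simpl; rewrite wallis_1; ring|].
assert (E := wallis_rec (2 * n + 1)).
replace (2 * S n + 1)%nat with (2 * n + 1 + 2)%nat by lia. cbn [odd_even_prod].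
replace (2 * n + 1 + 1)%nat with (2 * n + 2)%nat in E by lia.
assert (0 < INR (2 * n + 2)) by (apply lt_0_INR; lia).
transitivity (INR (2 * n + 1 + 2) * wallis (2 * n + 1 + 2) * odd_even_prod n * INR (2 * n + 1) / INR (2 * n + 2)); [field; lra|].
rewrite E. rewrite <- IHn. field. lra.
Qed.

(** Monotonicity of [wallis] at [2n - 1], [2n], [2n + 1]: the even value is [PI / 2] times the
    product, the odd ones are inverses of multiples of it, so both comparisons bound its square. *)
Lemma odd_even_prod_bounds n :
  / (INR n + 1) <= PI * odd_even_prod n ^ 2 /\
  PI * odd_even_prod n ^ 2 * INR n <= 1.
Proof.
set (w := odd_even_prod n).
assert (Hw : 0 < w) by apply odd_even_prod_pos.
assert (HP := PI_RGT_0).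
assert (E0 := wallis_even n). assert (E1 := wallis_odd n).
assert (D0 := wallis_decr (2 * n)). fold w in E0, E1.
replace (S (2 * n)) with (2 * n + 1)%nat in D0 by lia.
rewrite plus_INR, mult_INR in E1. simpl INR in E1.
assert (Hn := pos_INR n).
assert (H1 : 0 < (2 * INR n + 1) * w) by (apply Rmult_lt_0_compat; lra).
split.
- apply Rmult_le_reg_l with (INR n + 1); [lra|]. rewrite Rinv_r by lra.
  assert (wallis (2 * n + 1) * ((1 + 1) * INR n + 1) * w <= PI / 2 * w * ((2 * INR n + 1) * w)).
  { replace (wallis (2 * n + 1) * ((1 + 1) * INR n + 1) * w) with (wallis (2 * n + 1) * ((2 * INR n + 1) * w)) by ring.
    apply Rmult_le_compat_r; lra. }
  assert (0 <= PI * w ^ 2) by (apply Rmult_le_pos; [lra|nra]).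
  nra.
- destruct n as [|n]; [simpl; lra|].
  assert (E2 := wallis_odd n). assert (D1 := wallis_decr (2 * n + 1)).
  replace (S (2 * n + 1)) with (2 * S n)%nat in D1 by lia.
  unfold w in *; clear w. set (v := odd_even_prod n) in *.
  assert (Hv : 0 < v) by apply odd_even_prod_pos.
  assert (Ew : odd_even_prod (S n) * (2 * INR (S n)) = INR (2 * n + 1) * v).
  { cbn [odd_even_prod]. fold v.
    assert (INR (2 * n + 2) = 2 * INR (S n)).
    { rewrite S_INR, plus_INR, mult_INR; simpl; ring. }
    rewrite H. assert (0 < INR (S n)) by (apply lt_0_INR; lia). field. lra. }
  rewrite <- Ew in E2. set (w := odd_even_prod (S n)) in *.
  assert (wallis (2 * S n) * (w * (2 * INR (S n))) <= 1).
  { rewrite <- E2. apply Rmult_le_compat_r; [|lra]. apply Rmult_le_pos; lra. }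
  rewrite E0 in H. nra.
Qed.

(** * The cosine integral *)

Lemma ln_le_sub1 x : 0 < x -> ln x <= x - 1.
Proof.
intros Hx. assert (H := exp_ineq1_le (ln x)). rewrite exp_ln in H; lra.
Qed.

Lemma ln_ge_1_sub_inv x : 0 < x -> 1 - / x <= ln x.
Proof.
intros Hx. assert (H := ln_le_sub1 (/ x) (Rinv_0_lt_compat _ Hx)).
rewrite ln_Rinv in H; lra.
Qed.

Lemma ln_div x y : 0 < x -> 0 < y -> ln (x / y) = ln x - ln y.
Proof.
intros Hx Hy. unfold Rdiv. rewrite ln_mult, ln_Rinv; auto; try ring.
now apply Rinv_0_lt_compat.
Qed.

Definition harmonic (n : nat) : R := psum (fun k => / INR (S k)) n.

(** [Lim_seq] has a value even without a finite limit, so convergence has to be proved: by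
    [1 - 1/x <= ln x <= x - 1] at ratios of consecutive integers, the sequence decreases and stays
    nonnegative. *)
Lemma euler_gamma_lim :
  is_lim_seq (fun n => harmonic n - ln (INR n)) euler_gamma.
Proof.
apply is_lim_seq_incr_1.
assert (P : forall n, 0 < INR (S n)) by (intros; apply lt_0_INR; lia).
assert (E : ex_finite_lim_seq (fun n => harmonic (S n) - ln (INR (S n)))).
{ apply ex_finite_lim_seq_decr with 0.
  - intros n. unfold harmonic.
    change (psum (fun k => / INR (S k)) (S (S n))) with
      (psum (fun k => / INR (S k)) (S n) + / INR (S (S n))).
    assert (H := ln_ge_1_sub_inv (INR (S (S n)) / INR (S n))).
    rewrite ln_div in H by auto.
    assert (P1 := P n). assert (P2 := P (S n)).
    assert (1 - / (INR (S (S n)) / INR (S n)) = / INR (S (S n))).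
    { rewrite (S_INR (S n)). field. lra. }
    assert (0 < INR (S (S n)) / INR (S n)) by (apply Rdiv_lt_0_compat; auto). lra.
  - intros n.
    assert (H : forall m, ln (INR (S m)) <= harmonic m).
    { induction m as [|m IH]; [unfold harmonic; simpl; rewrite ln_1; lra|].
      unfold harmonic in *; cbn [psum].
      assert (P1 := P m). assert (P2 := P (S m)).
      assert (H := ln_le_sub1 (INR (S (S m)) / INR (S m)) ltac:(apply Rdiv_lt_0_compat; auto)).
      rewrite ln_div in H by auto.
      replace (INR (S (S m)) / INR (S m) - 1) with (/ INR (S m)) in H
        by (rewrite (S_INR (S m)); field; lra).
      lra. }
    assert (H1 := H (S n)).
    assert (ln (INR (S n)) <= ln (INR (S (S n)))).
    { apply ln_le; auto. apply le_INR; lia. }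
    lra. }
replace euler_gamma with (real (Lim_seq (fun n => harmonic (S n) - ln (INR (S n))))).
- apply Lim_seq_correct'. exact E.
- unfold euler_gamma. f_equal. apply Lim_seq_ext. intros n. rewrite psum_sum_n. reflexivity.
Qed.

Lemma one_minus_cos_le x : 0 <= 1 - cos x <= x ^ 2 / 2.
Proof.
assert (H : forall y, 0 <= y -> Rabs (cos y - cos 0) <= y ^ 2 / 2 - 0 ^ 2 / 2).
{ intros y Hy. apply (incr_bound cos (fun y => y ^ 2 / 2) (fun y => - sin y) (fun y => y)); auto.
  - intros; auto_derive; auto; ring.
  - intros; auto_derive; auto; field.
  - intros z Hz. rewrite Rabs_Ropp.
    assert (Q : Rabs (sin z - sin 0) <= 1 * (z - 0)).
    { apply (lipschitz_bound sin cos); [lra| |].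
      + intros; auto_derive; auto; ring.
      + intros; apply Rabs_le, COS_bound. }
    rewrite sin_0, Rminus_0_r in Q. lra. }
assert (H2 : Rabs (cos x - cos 0) <= x ^ 2 / 2).
{ destruct (Rle_dec 0 x).
  - specialize (H x r). lra.
  - specialize (H (- x)). rewrite cos_neg in H. replace (x ^ 2) with ((- x) ^ 2) by ring. lra. }
rewrite cos_0 in H2. assert (B := COS_bound x).
rewrite Rabs_minus_sym, Rabs_pos_eq in H2; lra.
Qed.

Lemma sin_ge_cubic x : 0 <= x <= 4 -> x - x ^ 3 / 6 <= sin x.
Proof.
intros Hx. destruct (pre_sin_bound x 0) as [H _]; try lra.
unfold sin_approx, sin_term in H. simpl in H.
unfold Rdiv in *. lra.
Qed.

(* At [y = 0] Rocq's division gives 0, the limit value. *)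
Definition cinc (y : R) : R := (1 - cos y) / y.

Lemma cinc_0 : cinc 0 = 0.
Proof. unfold cinc, Rdiv. rewrite Rinv_0. ring. Qed.

Lemma cinc_abs_le y : Rabs (cinc y) <= Rabs y / 2.
Proof.
destruct (Req_dec y 0) as [->|Hy]; [rewrite cinc_0, Rabs_R0; lra|].
unfold cinc. rewrite Rabs_div by auto.
assert (H := one_minus_cos_le y). rewrite (Rabs_pos_eq (1 - cos y)) by lra.
assert (Ha : 0 < Rabs y) by now apply Rabs_pos_lt.
apply Rmult_le_reg_r with (Rabs y); auto.
unfold Rdiv. rewrite Rmult_assoc, Rinv_l by lra.
replace (Rabs y * / 2 * Rabs y) with (Rabs y ^ 2 / 2) by field.
rewrite pow2_abs. lra.
Qed.

Lemma continuous_cinc y : continuous cinc y.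
Proof.
destruct (Req_dec y 0) as [->|Hy].
- apply filterlim_locally. intros eps. exists eps. intros z Hz.
  rewrite cinc_0. change (Rabs (cinc z - 0) < eps). change (Rabs (z - 0) < eps) in Hz.
  rewrite Rminus_0_r in *. assert (H := cinc_abs_le z).
  assert (H' := Rabs_pos z). lra.
- apply (ex_derive_continuous cinc). unfold cinc. auto_derive. auto.
Qed.

Lemma ex_RInt_cinc a b : ex_RInt cinc a b.
Proof.
apply (ex_RInt_continuous (V := R_CompleteNormedModule)).
intros; apply continuous_cinc.
Qed.

Definition Cin (z : R) : R := RInt cinc 0 z.

Lemma Cin_0 : Cin 0 = 0.
Proof. exact (RInt_point 0 cinc). Qed.

Lemma is_derive_Cin z : is_derive Cin z (cinc z).
Proof.
apply (is_derive_RInt cinc Cin 0 z).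
- apply filter_forall. intros y.
  apply (RInt_correct (V := R_CompleteNormedModule)), ex_RInt_cinc.
- apply continuous_cinc.
Qed.

Lemma is_derive_Cin_scal a z :
  is_derive (fun x => Cin (a * x)) z (a * cinc (a * z)).
Proof.
apply (is_derive_comp Cin (fun x => a * x)).
- apply is_derive_Cin.
- auto_derive; auto; ring.
Qed.

(** The derivative of [Cin - ln] is [- cos x / x], not absolutely integrable at infinity. Adding
    [sin x / x] turns it into [- sin x / x ^ 2], which costs [1/z - 1/z']; the two added boundary
    terms cost [1/z + 1/z']. *)
Lemma Cin_ln_cauchy z z' : 0 < z <= z' ->
  Rabs ((Cin z' - ln z') - (Cin z - ln z)) <= 2 / z.
Proof.
intros Hz.
assert (H : Rabs ((Cin z' - ln z' + sin z' / z') - (Cin z - ln z + sin z / z))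
            <= - / z' - - / z).
{ apply (incr_bound (fun z => Cin z - ln z + sin z / z) (fun z => - / z)
           (fun z => cinc z - / z + (cos z / z - sin z / z ^ 2)) (fun z => / z ^ 2)).
  - lra.
  - intros x Hx. apply (is_derive_plus (fun z => Cin z - ln z) (fun z => sin z / z)).
    + apply (is_derive_minus Cin ln); [apply is_derive_Cin|apply is_derive_ln; lra].
    + auto_derive; [lra|field; lra].
  - intros x Hx. auto_derive; [lra|field; lra].
  - intros x Hx. unfold cinc.
    replace ((1 - cos x) / x - / x + (cos x / x - sin x / x ^ 2)) with (- sin x * / x ^ 2)
      by (field; lra).
    assert (0 < / x ^ 2) by (apply Rinv_0_lt_compat, pow_lt; lra).
    rewrite Rabs_mult, Rabs_Ropp, (Rabs_pos_eq (/ x ^ 2)) by lra.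
    assert (Rabs (sin x) <= 1) by apply Rabs_le, SIN_bound. nra. }
assert (B : forall x, 0 < x -> Rabs (sin x / x) <= / x).
{ intros x Hx. unfold Rdiv. assert (0 < / x) by now apply Rinv_0_lt_compat.
  rewrite Rabs_mult, (Rabs_pos_eq (/ x)) by lra.
  assert (Rabs (sin x) <= 1) by apply Rabs_le, SIN_bound. nra. }
assert (B1 := B z ltac:(lra)). assert (B2 := B z' ltac:(lra)).
apply Rabs_le_between in H. apply Rabs_le_between in B1. apply Rabs_le_between in B2.
unfold Rdiv at 1. apply Rabs_le. lra.
Qed.

(** * Euler's constant in the cosine integral *)

Lemma psum_sin_odd N x :
  2 * sin x * psum (fun k => sin ((2 * INR k + 1) * x)) N = 1 - cos (2 * INR N * x).
Proof.
induction N.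
- simpl. replace (2 * 0 * x) with 0 by ring. rewrite cos_0. ring.
- cbn [psum]. rewrite Rmult_plus_distr_l, IHN, S_INR.
  replace (2 * INR N * x) with ((2 * INR N + 1) * x - x) by ring.
  replace (2 * (INR N + 1) * x) with ((2 * INR N + 1) * x + x) by ring.
  rewrite cos_plus, cos_minus. ring.
Qed.

(** The kernel for odd frequencies has the factor [1 / sin x], while [Cin] has [1 / x]. This is the
    discrepancy, bounded near [0]. *)
Definition csc_sub_inv (x : R) : R := / sin x - / x.

Lemma csc_sub_inv_bound x : 0 < x <= 1 -> 0 <= csc_sub_inv x <= 1.
Proof.
intros Hx. unfold csc_sub_inv.
assert (H1 := sin_ge_cubic x ltac:(lra)). assert (H2 := sin_lt_x x ltac:(lra)).
assert (Hs : 5 / 6 * x <= sin x).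
{ assert (x ^ 3 <= x). { simpl. assert (x * x <= 1) by nra. nra. } lra. }
replace (/ sin x - / x) with ((x - sin x) / (x * sin x)) by (field; lra).
assert (0 < x * sin x) by (apply Rmult_lt_0_compat; lra).
split.
- apply Rdiv_le_0_compat; lra.
- apply Rle_div_l; auto. simpl in *. assert (x * (5 / 6 * x) <= x * sin x) by (apply Rmult_le_compat_l; lra). nra.
Qed.

(** The primitive [ln (tan (x / 2) / x)] of [csc_sub_inv]. It tends to [- ln 2] at [0] and equals
    [ln (2 / PI)] at [PI / 2]. *)
Definition log_tan_div (x : R) : R := ln (sin (x / 2)) - ln (cos (x / 2)) - ln x.

Lemma is_derive_log_tan_div x : 0 < x <= PI / 2 ->
  is_derive log_tan_div x (csc_sub_inv x).
Proof.
intros Hx. assert (HP := PI_RGT_0).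
assert (Hs : 0 < sin (x / 2)) by (apply sin_gt_0; lra).
assert (Hc : 0 < cos (x / 2)) by (apply cos_gt_0; lra).
unfold log_tan_div, csc_sub_inv. auto_derive; [repeat split; lra|].
replace (sin x) with (2 * sin (x / 2) * cos (x / 2))
  by (rewrite <- sin_2a; f_equal; field).
assert (E := sin2_cos2 (x / 2)). unfold Rsqr in E.
replace (x * / 2) with (x / 2) in * by reflexivity.
transitivity ((sin (x / 2) * sin (x / 2) + cos (x / 2) * cos (x / 2)) / (2 * sin (x / 2) * cos (x / 2)) - / x).
- field. lra.
- rewrite E. field. lra.
Qed.

Lemma log_tan_div_near_0 d : 0 < d <= 1 -> Rabs (log_tan_div d + ln 2) <= d.
Proof.
intros Hd. unfold log_tan_div.
assert (Hs1 := sin_ge_cubic (d / 2) ltac:(lra)). assert (Hs2 := sin_lt_x (d / 2) ltac:(lra)).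
assert (Hc := one_minus_cos_le (d / 2)).
assert (Hd2 : 0 < d ^ 2 <= d) by (simpl; nra).
set (s := sin (d / 2)) in *. set (c := cos (d / 2)) in *.
assert (Hs : (1 - d / 24) * (d / 2) <= s).
{ simpl in *. assert (d * d * d <= d * d) by nra. lra. }
assert (Hs0 : 0 < s) by nra.
assert (Hc0 : 1 - d / 8 <= c <= 1) by (simpl in *; lra).
replace (ln s - ln c - ln d + ln 2) with (ln (s / (d / 2)) - ln c)
  by (rewrite ln_div by lra; rewrite ln_div by lra; ring).
assert (Q : 1 - d / 24 <= s / (d / 2) <= 1).
{ split; [apply Rle_div_r; lra|apply Rle_div_l; lra]. }
assert (L : forall y e, 1 - e <= y <= 1 -> 0 < e <= d / 8 -> - (d / 4) <= ln y <= 0).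
{ intros y e Hy He. split.
  - apply Rle_trans with (2 := ln_ge_1_sub_inv y ltac:(lra)).
    assert (/ y <= / (1 - d / 8)) by (apply Rinv_le_contravar; lra).
    assert (/ (1 - d / 8) <= 1 + d / 4).
    { apply Rmult_le_reg_l with (1 - d / 8); [lra|]. rewrite Rinv_r by lra. simpl in *; nra. }
    lra.
  - assert (H := ln_le_sub1 y ltac:(lra)). lra. }
assert (L1 := L _ (d / 24) Q ltac:(lra)). assert (L2 := L _ (d / 8) Hc0 ltac:(lra)).
apply Rabs_le. lra.
Qed.

(** Both sums are values at [PI / 2] of primitives, and the derivative of their difference is
    [(1 - cos (2 N x)) / 2 * csc_sub_inv x]. The non-oscillating half integrates to
    [(ln (2 / PI) + ln 2) / 2], which gives the constants. The oscillating half is integrated by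
    parts on [[d, PI / 2]], and [[0, d]] is estimated trivially. *)
Lemma odd_harmonic_Cin_estimate d : 0 < d <= 1 ->
  exists C, forall N, (0 < N)%nat ->
  Rabs (psum (fun k => / (2 * INR k + 1)) N - Cin (PI * INR N) / 2 - ln 2 + ln PI / 2)
   <= 2 * d + C / INR N.
Proof.
intros Hd. assert (HP := PI_RGT_0). assert (HP1 := PI2_1).
assert (Hsd : 0 < sin d) by (apply sin_gt_0; lra).
(* On [[d, PI / 2]], [C0] bounds the derivative of [csc_sub_inv] and [C1] bounds [csc_sub_inv]
   itself. *)
set (C0 := / sin d ^ 2 + / d ^ 2). set (C1 := / sin d + / d).
exists (C0 * PI / 8 + C1 / 2). intros N HN.
assert (HNr : 0 < INR N) by now apply lt_0_INR.
assert (Hodd : forall k, 0 < 2 * INR k + 1) by (intros k; assert (H := pos_INR k); lra).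
set (f := fun x => psum (fun k => (1 - cos ((2 * INR k + 1) * x)) / (2 * INR k + 1)) N
                   - Cin (2 * INR N * x) / 2).
set (df := fun x => psum (fun k => sin ((2 * INR k + 1) * x)) N
                   - INR N * cinc (2 * INR N * x)).
assert (Hf : forall x, is_derive f x (df x)).
{ intros x. apply (is_derive_minus (fun x => psum (fun k => (1 - cos ((2 * INR k + 1) * x)) / (2 * INR k + 1)) N)
                     (fun x => Cin (2 * INR N * x) / 2)).
  - apply (is_derive_psum (fun k x => (1 - cos ((2 * INR k + 1) * x)) / (2 * INR k + 1))
       (fun k x => sin ((2 * INR k + 1) * x))).
    intros k. specialize (Hodd k). auto_derive; auto. field. lra.
  - replace (INR N * cinc (2 * INR N * x)) with (2 * INR N * cinc (2 * INR N * x) / 2) by field.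
    apply (is_derive_Rdiv (fun x => Cin (2 * INR N * x))). apply is_derive_Cin_scal. }
assert (Hdf : forall x, 0 < x <= PI / 2 ->
          df x = (1 - cos (2 * INR N * x)) / 2 * csc_sub_inv x).
{ intros x Hx. assert (0 < sin x) by (apply sin_gt_0; lra).
  unfold df, csc_sub_inv, cinc. assert (E := psum_sin_odd N x).
  apply Rmult_eq_reg_l with (2 * sin x); [|lra].
  rewrite Rmult_minus_distr_l, E. field. lra. }
assert (f0 : f 0 = 0).
{ unfold f. rewrite Rmult_0_r, Cin_0.
  rewrite psum_eq0; [field|]. intros. rewrite Rmult_0_r, cos_0. unfold Rdiv. ring. }
assert (H1 : Rabs (f d - f 0) <= 1 * (d - 0)).
{ apply lipschitz_bound with df; [lra|intros; apply Hf|].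
  intros x Hx. destruct (Req_dec x 0) as [->|Hx0].
  - unfold df. rewrite Rmult_0_r, cinc_0.
    rewrite psum_eq0; [rewrite Rabs_pos_eq; lra|]. intros. now rewrite Rmult_0_r, sin_0.
  - rewrite Hdf by lra. assert (B := csc_sub_inv_bound x ltac:(lra)).
    assert (B2 := COS_bound (2 * INR N * x)). rewrite Rabs_pos_eq; nra. }
rewrite f0 in H1.
(* The second term removes the mean of [f'], the third is the boundary term of the integration by
   parts, so that [g'] is of order [1 / N]. *)
set (g := fun x => f x - log_tan_div x / 2 + sin (2 * INR N * x) * csc_sub_inv x / (4 * INR N)).
assert (Bs : forall x, d <= x <= PI / 2 -> 0 < / sin x <= / sin d /\ 0 < / x <= / d).
{ intros x Hx. assert (sin d <= sin x) by (apply sin_incr_1; lra).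
  repeat split; try (apply Rinv_0_lt_compat; lra); apply Rinv_le_contravar; lra. }
assert (H2 : Rabs (g (PI / 2) - g d) <= C0 / (4 * INR N) * (PI / 2 - d)).
{ apply lipschitz_bound with
    (fun x => sin (2 * INR N * x) * (/ x ^ 2 - cos x / sin x ^ 2) / (4 * INR N)); [lra| |].
  - intros x Hx. assert (0 < sin x) by (apply sin_gt_0; lra).
    replace (sin (2 * INR N * x) * (/ x ^ 2 - cos x / sin x ^ 2) / (4 * INR N)) with
     (df x - csc_sub_inv x / 2 + (sin (2 * INR N * x) * (/ x ^ 2 - cos x / sin x ^ 2) / (4 * INR N)
         + cos (2 * INR N * x) * csc_sub_inv x / 2))
      by (rewrite Hdf by lra; field; lra).
    apply (is_derive_plus (fun x => f x - log_tan_div x / 2)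
       (fun x => sin (2 * INR N * x) * csc_sub_inv x / (4 * INR N))).
    + apply (is_derive_minus f (fun x => log_tan_div x / 2)); auto.
      apply (is_derive_Rdiv log_tan_div). apply is_derive_log_tan_div; lra.
    + unfold csc_sub_inv. auto_derive; [repeat split; lra|]. field. lra.
  - intros x Hx. destruct (Bs x Hx) as [B1 B2].
    assert (B3 : Rabs (sin (2 * INR N * x)) <= 1) by apply Rabs_le, SIN_bound.
    assert (B4 : Rabs (/ x ^ 2 - cos x / sin x ^ 2) <= C0).
    { unfold Rminus. apply Rle_trans with (1 := Rabs_triang _ _). rewrite Rabs_Ropp.
      unfold C0. rewrite Rplus_comm. unfold Rdiv.
      apply Rplus_le_compat.
      - rewrite Rabs_mult. assert (Rabs (cos x) <= 1) by apply Rabs_le, COS_bound.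
        rewrite (Rabs_pos_eq (/ sin x ^ 2)).
        2: { rewrite <- pow_inv. apply pow2_ge_0. }
        rewrite <- !pow_inv.
        assert ((/ sin x) ^ 2 <= (/ sin d) ^ 2) by (apply pow_incr; lra).
        assert (0 <= (/ sin x) ^ 2) by apply pow2_ge_0. nra.
      - rewrite <- !pow_inv. rewrite Rabs_pos_eq by apply pow2_ge_0. apply pow_incr; lra. }
    unfold Rdiv. rewrite !Rabs_mult.
    rewrite (Rabs_pos_eq (/ (4 * INR N))) by (left; apply Rinv_0_lt_compat; lra).
    apply Rmult_le_compat_r; [left; apply Rinv_0_lt_compat; lra|].
    assert (Hp := Rabs_pos (/ x ^ 2 - cos x * / sin x ^ 2)).
    unfold Rdiv in B4. nra. }
assert (Bo : forall x, d <= x <= PI / 2 ->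
   Rabs (sin (2 * INR N * x) * csc_sub_inv x / (4 * INR N)) <= C1 / (4 * INR N)).
{ intros x Hx. destruct (Bs x Hx) as [B1 B2].
  unfold Rdiv. rewrite Rabs_mult, (Rabs_pos_eq (/ (4 * INR N))) by (left; apply Rinv_0_lt_compat; lra).
  apply Rmult_le_compat_r; [left; apply Rinv_0_lt_compat; lra|].
  rewrite Rabs_mult.
  assert (B3 : Rabs (sin (2 * INR N * x)) <= 1) by apply Rabs_le, SIN_bound.
  assert (B4 : Rabs (csc_sub_inv x) <= C1).
  { unfold csc_sub_inv, C1. apply Rabs_le. lra. }
  assert (Hp := Rabs_pos (csc_sub_inv x)). nra. }
assert (O1 := Bo (PI / 2) ltac:(lra)). assert (O2 := Bo d ltac:(lra)).
assert (L := log_tan_div_near_0 d Hd).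
assert (C0p : 0 < C0).
{ unfold C0. apply Rplus_lt_0_compat; apply Rinv_0_lt_compat, pow_lt; lra. }
assert (H2' : C0 / (4 * INR N) * (PI / 2 - d) <= C0 * PI / 8 / INR N).
{ replace (C0 * PI / 8 / INR N) with (C0 / (4 * INR N) * (PI / 2)) by (field; lra).
  apply Rmult_le_compat_l; [|lra]. left; apply Rdiv_lt_0_compat; lra. }
(* All cosines of odd multiples of [PI / 2] vanish, so the odd harmonic sum is what remains. *)
assert (Ef : f (PI / 2) = psum (fun k => / (2 * INR k + 1)) N - Cin (PI * INR N) / 2).
{ unfold f. f_equal.
  - apply psum_ext. intros k _. unfold Rdiv.
    replace ((2 * INR k + 1) * (PI * / 2)) with (PI / 2 + INR k * PI) by field.
    replace (cos (PI / 2 + INR k * PI)) with 0; [ring|].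
    symmetry. rewrite cos_plus, cos_PI2.
    replace (sin (INR k * PI)) with 0; [ring|]. symmetry. apply sin_eq_0_1.
    exists (Z.of_nat k). now rewrite <- INR_IZR_INZ.
  - do 2 f_equal. field. }
assert (Et : log_tan_div (PI / 2) = ln 2 - ln PI).
{ unfold log_tan_div. replace (PI / 2 / 2) with (PI / 4) by field.
  rewrite sin_cos_PI4. rewrite (ln_div PI 2) by lra. ring. }
replace ((C0 * PI / 8 + C1 / 2) / INR N) with (C0 * PI / 8 / INR N + 2 * (C1 / (4 * INR N)))
  by (field; lra).
unfold g in H2. rewrite Ef, Et in H2.
apply Rabs_le_between in H1. apply Rabs_le_between in H2. apply Rabs_le_between in O1.
apply Rabs_le_between in O2. apply Rabs_le_between in L.
apply Rabs_le. lra.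
Qed.

Lemma odd_harmonic N :
  psum (fun k => / (2 * INR k + 1)) N = harmonic (2 * N) - harmonic N / 2.
Proof.
induction N; [simpl; unfold harmonic; simpl; field|].
replace (2 * S N)%nat with (S (S (2 * N))) by lia.
unfold harmonic in *. cbn [psum]. rewrite IHN, !S_INR, mult_INR. simpl INR.
assert (H := pos_INR N). field. lra.
Qed.

(** Writing the odd harmonic sum through [harmonic (2 * N)] and [harmonic N] expresses the sequence
    as [2 h(2N) - h(N)] up to a null sequence, with [h = harmonic - ln]; the multiples of [ln 2]
    cancel. *)
Lemma Cin_PI_lim : is_lim_seq (fun N => Cin (PI * INR N) - ln (PI * INR N)) euler_gamma.
Proof.
assert (HP := PI_RGT_0).
set (h := fun N => harmonic N - ln (INR N)).
assert (Hh := euler_gamma_lim). fold h in Hh.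
assert (Hh2 : is_lim_seq (fun N => h (2 * N)%nat) euler_gamma).
{ apply (is_lim_seq_subseq h); auto. apply eventually_subseq. intros; lia. }
set (r := fun N => psum (fun k => / (2 * INR k + 1)) N - Cin (PI * INR N) / 2 - ln 2 + ln PI / 2).
assert (Hr : is_lim_seq r 0).
{ apply is_lim_seq_0_eps. intros d Hd.
  destruct (odd_harmonic_Cin_estimate d) as [C HC]; [lra|].
  exists C. intros N HN. apply Rle_trans with (1 := HC N HN). lra. }
apply is_lim_seq_ext_loc with (fun N => 2 * h (2 * N)%nat - h N - 2 * r N).
- exists 1%nat. intros N HN. unfold h, r.
  assert (0 < INR N) by (apply lt_0_INR; lia).
  rewrite odd_harmonic, mult_INR, !ln_mult by (simpl; lra).
  simpl INR. replace (1 + 1) with 2 by ring. field.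
- replace (Finite euler_gamma) with (Rbar_minus (Rbar_minus (Rbar_mult 2 euler_gamma) euler_gamma) (Rbar_mult 2 0))
    by (simpl; f_equal; ring).
  apply is_lim_seq_minus'; [apply is_lim_seq_minus'|]; auto.
  + now apply (is_lim_seq_scal_l _ 2 euler_gamma).
  + now apply (is_lim_seq_scal_l _ 2 0).
Qed.

Lemma Cin_asymptotic z : 0 < z -> Rabs (Cin z - ln z - euler_gamma) <= 2 / z.
Proof.
intros Hz. assert (HP := PI_RGT_0).
rewrite Rabs_minus_sym.
apply (is_lim_seq_le_loc (fun N => Rabs (Cin (PI * INR N) - ln (PI * INR N) - (Cin z - ln z)))
         (fun _ => 2 / z) (Rabs (euler_gamma - (Cin z - ln z))) (2 / z)).
- destruct (archimed_cor1 (PI / z)) as [M [HM HM0]]; [apply Rdiv_lt_0_compat; lra|].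
  exists M. intros N HN.
  apply Cin_ln_cauchy. split; auto.
  apply le_INR in HN. apply lt_0_INR in HM0.
  assert (z < PI * INR M).
  { apply Rmult_lt_reg_l with (/ INR M); [now apply Rinv_0_lt_compat|].
    replace (/ INR M * (PI * INR M)) with (PI / z * z) by (field; lra).
    now apply Rmult_lt_compat_r. }
  nra.
- apply (is_lim_seq_abs _ (euler_gamma - (Cin z - ln z))).
  apply is_lim_seq_minus'; [apply Cin_PI_lim|apply is_lim_seq_const].
- apply is_lim_seq_const.
Qed.

(** * The square wave *)

Definition leibniz (m : nat) : R := psum (fun k => (-1) ^ k / (2 * INR k + 1)) m.

Definition sqwave (m : nat) (y : R) : R :=
  psum (fun k => (-1) ^ k * ((1 - cos ((2 * INR k + 1) * y)) / (2 * INR k + 1))) m.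

Definition Cin_sum (m : nat) (y : R) : R :=
  psum (fun k => (-1) ^ k / (2 * INR k + 1) * Cin ((2 * INR k + 1) * y)) m.

Lemma two_INR_plus_1_pos k : 0 < 2 * INR k + 1.
Proof. assert (H := pos_INR k). lra. Qed.

Lemma is_derive_Cin_sum m y : is_derive (Cin_sum m) y (sqwave m y / y).
Proof.
replace (sqwave m y / y) with
  (psum (fun k => (-1) ^ k / (2 * INR k + 1) *
           ((2 * INR k + 1) * cinc ((2 * INR k + 1) * y))) m).
- apply (is_derive_psum (fun k y => (-1) ^ k / (2 * INR k + 1) * Cin ((2 * INR k + 1) * y))
    (fun k y => (-1) ^ k / (2 * INR k + 1) * ((2 * INR k + 1) * cinc ((2 * INR k + 1) * y)))).
  intros k. apply (is_derive_scal (fun y => Cin ((2 * INR k + 1) * y))).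
  apply is_derive_Cin_scal.
- unfold sqwave, Rdiv at 2. rewrite Rmult_comm, <- psum_scal.
  apply psum_ext. intros k _. assert (H := two_INR_plus_1_pos k).
  unfold cinc, Rdiv. rewrite Rinv_mult.
  transitivity ((-1) ^ k * (/ (2 * INR k + 1) * (2 * INR k + 1)) *
     ((1 - cos ((2 * INR k + 1) * y)) * (/ (2 * INR k + 1) * / y))); [ring|].
  rewrite Rinv_l by lra. ring.
Qed.

Lemma psum_alt_sin m y :
  2 * cos y * psum (fun k => (-1) ^ k * sin ((2 * INR k + 1) * y)) m
  = - ((-1) ^ m * sin (2 * INR m * y)).
Proof.
induction m.
- simpl. replace (2 * 0 * y) with 0 by ring. rewrite sin_0. ring.
- cbn [psum]. rewrite Rmult_plus_distr_l, IHm, S_INR.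
  replace (2 * INR m * y) with ((2 * INR m + 1) * y - y) by ring.
  replace (2 * (INR m + 1) * y) with ((2 * INR m + 1) * y + y) by ring.
  rewrite sin_plus, sin_minus. simpl. ring.
Qed.

Lemma is_derive_sqwave m y :
  is_derive (sqwave m) y (psum (fun k => (-1) ^ k * sin ((2 * INR k + 1) * y)) m).
Proof.
apply (is_derive_psum
  (fun k y => (-1) ^ k * ((1 - cos ((2 * INR k + 1) * y)) / (2 * INR k + 1)))
  (fun k y => (-1) ^ k * sin ((2 * INR k + 1) * y))).
intros k. assert (H := two_INR_plus_1_pos k).
auto_derive; auto. field. lra.
Qed.

Lemma sqwave_deriv_cos m y : 0 < cos y ->
  psum (fun k => (-1) ^ k * sin ((2 * INR k + 1) * y)) m
  = - ((-1) ^ m * sin (2 * INR m * y)) / (2 * cos y).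
Proof.
intros H. rewrite <- psum_alt_sin. field. lra.
Qed.

Lemma sqwave_0 m : sqwave m 0 = 0.
Proof.
apply psum_eq0. intros k _. rewrite Rmult_0_r, cos_0. unfold Rdiv. ring.
Qed.

Lemma sqwave_neg m y : sqwave m (- y) = sqwave m y.
Proof.
apply psum_ext. intros k _. rewrite Ropp_mult_distr_r_reverse, cos_neg. reflexivity.
Qed.

(** Keeps [sqwave m y / y] bounded near [0] uniformly in [m]. The derivative is a sine over
    [2 cos y], up to sign, and [cos y >= 1/2] here. *)
Lemma sqwave_le_linear m y : 0 <= y <= 1 / 2 -> Rabs (sqwave m y) <= y.
Proof.
intros Hy. rewrite <- (Rminus_0_r (sqwave m y)), <- (sqwave_0 m).
replace y with (1 * (y - 0)) at 2 by ring.
apply (lipschitz_bound (sqwave m) _ 1 0 y ltac:(lra) (fun x _ => is_derive_sqwave m x)).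
intros x Hx. assert (Hc := one_minus_cos_le x).
assert (Hc2 : 1 / 2 <= cos x) by (simpl in Hc; nra).
rewrite sqwave_deriv_cos by lra.
unfold Rdiv. rewrite Rabs_mult, Rabs_Ropp, Rabs_mult, pow_1_abs, Rmult_1_l.
assert (Rabs (sin (2 * INR m * x)) <= 1) by apply Rabs_le, SIN_bound.
assert (0 < / (2 * cos x) <= 1).
{ split; [apply Rinv_0_lt_compat; lra|]. rewrite <- Rinv_1. apply Rinv_le_contravar; lra. }
rewrite (Rabs_pos_eq (/ (2 * cos x))) by lra.
assert (Hp := Rabs_pos (sin (2 * INR m * x))). nra.
Qed.

(* One integration by parts in the Dirichlet-type kernel [sin (2 m y) / (2 cos y)]. *)
Lemma sqwave_decay m y : (0 < m)%nat -> 0 <= y < PI / 2 ->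
  Rabs (sqwave m y) <= / (2 * INR m * cos y).
Proof.
intros Hm Hy. apply lt_0_INR in Hm.
assert (HC : forall x, 0 <= x <= y -> 0 < cos x) by (intros; apply cos_gt_0; lra).
set (E := fun x => sqwave m x - (-1) ^ m * (cos (2 * INR m * x) / (4 * INR m * cos x))).
assert (H : Rabs (E y - E 0) <= / (4 * INR m * cos y) - / (4 * INR m * cos 0)).
{ apply (incr_bound E (fun x => / (4 * INR m * cos x))
    (fun x => - (-1) ^ m * (cos (2 * INR m * x) * sin x / (4 * INR m * cos x ^ 2)))
    (fun x => sin x / (4 * INR m * cos x ^ 2))); [lra| | |].
  - intros x Hx. specialize (HC x Hx).
    replace (- (-1) ^ m * (cos (2 * INR m * x) * sin x / (4 * INR m * cos x ^ 2))) with
     (psum (fun k => (-1) ^ k * sin ((2 * INR k + 1) * x)) m -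
      (-1) ^ m * (- sin (2 * INR m * x) / (2 * cos x) + cos (2 * INR m * x) * sin x / (4 * INR m * cos x ^ 2)))
     by (rewrite sqwave_deriv_cos by auto; field; lra).
    apply (is_derive_minus (sqwave m) (fun x => (-1) ^ m * (cos (2 * INR m * x) / (4 * INR m * cos x)))).
    + apply is_derive_sqwave.
    + apply (is_derive_scal (fun x => cos (2 * INR m * x) / (4 * INR m * cos x))).
      auto_derive; [apply Rmult_integral_contrapositive; lra|]. field. lra.
  - intros x Hx. specialize (HC x Hx).
    auto_derive; [apply Rmult_integral_contrapositive; lra|]. field. lra.
  - intros x Hx. specialize (HC x Hx).
    assert (0 <= sin x) by (apply sin_ge_0; lra).
    assert (Hd : 0 <= sin x / (4 * INR m * cos x ^ 2)).
    { apply Rdiv_le_0_compat; auto. apply Rmult_lt_0_compat; [lra|apply pow_lt; auto]. }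
    rewrite Rabs_mult, Rabs_Ropp, pow_1_abs, Rmult_1_l.
    unfold Rdiv in *. rewrite Rmult_assoc, Rabs_mult, (Rabs_pos_eq (sin x * _)) by auto.
    assert (Rabs (cos (2 * INR m * x)) <= 1) by apply Rabs_le, COS_bound.
    assert (Hp := Rabs_pos (cos (2 * INR m * x))). nra. }
unfold E in H. rewrite sqwave_0, Rmult_0_r, cos_0, Rmult_1_r in H.
specialize (HC y ltac:(lra)).
assert (Hi : 0 < / (4 * INR m * cos y)).
{ apply Rinv_0_lt_compat, Rmult_lt_0_compat; lra. }
assert (Hi0 : 0 < / (4 * INR m)) by (apply Rinv_0_lt_compat; lra).
replace (/ (2 * INR m * cos y)) with (2 * / (4 * INR m * cos y)) by (field; lra).
assert (B1 : Rabs ((-1) ^ m * (cos (2 * INR m * y) / (4 * INR m * cos y))) <= / (4 * INR m * cos y)).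
{ unfold Rdiv. rewrite Rabs_mult, pow_1_abs, Rmult_1_l, Rabs_mult, (Rabs_pos_eq (/ _)) by lra.
  assert (Rabs (cos (2 * INR m * y)) <= 1) by apply Rabs_le, COS_bound. nra. }
assert (B2 : Rabs ((-1) ^ m * (1 / (4 * INR m))) <= / (4 * INR m)).
{ unfold Rdiv. rewrite Rabs_mult, pow_1_abs, !Rmult_1_l, Rabs_pos_eq; lra. }
apply Rabs_le_between in H. apply Rabs_le_between in B1. apply Rabs_le_between in B2.
apply Rabs_le. lra.
Qed.

Lemma sqwave_decay_away m d v : (0 < m)%nat -> 0 < d -> Rabs v <= PI / 2 - d ->
  Rabs (sqwave m v) <= / (2 * INR m * sin d).
Proof.
intros Hm Hd Hv. assert (Hp := Rabs_pos v).
replace (sqwave m v) with (sqwave m (Rabs v))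
  by (unfold Rabs; destruct (Rcase_abs v); auto using sqwave_neg).
apply Rle_trans with (1 := sqwave_decay m (Rabs v) Hm ltac:(lra)).
apply lt_0_INR in Hm. assert (HP := PI_RGT_0).
assert (0 < sin d) by (apply sin_gt_0; lra).
apply Rinv_le_contravar; [apply Rmult_lt_0_compat; lra|].
apply Rmult_le_compat_l; [lra|]. rewrite <- cos_shift.
apply cos_decr_1; lra.
Qed.

(** Up to distance [1/m] from the jump the decay estimate is already at most [1], since
    [sin (1/m) >= 1/(2m)]. On the last stretch, of length [1/m], the derivative is a sum of [m]
    terms of modulus at most [1], which adds at most [1]. *)
Lemma sqwave_bounded m v : (0 < m)%nat -> Rabs v <= PI / 2 -> Rabs (sqwave m v) <= 2.
Proof.
intros Hm Hv. assert (HP := PI2_3_2). assert (Hm' := lt_0_INR m Hm).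
assert (H1 : 1 <= INR m) by (apply (le_INR 1); lia).
assert (Hi : 0 < / INR m <= 1).
{ split; [now apply Rinv_0_lt_compat|]. rewrite <- Rinv_1. apply Rinv_le_contravar; lra. }
set (v0 := PI / 2 - / INR m).
assert (B : forall y, Rabs y <= v0 -> Rabs (sqwave m y) <= 1).
{ intros y Hy. apply Rle_trans with (1 := sqwave_decay_away m _ y Hm (proj1 Hi) Hy).
  assert (Hs := sin_ge_cubic (/ INR m) ltac:(lra)).
  assert (/ INR m / 2 <= sin (/ INR m)).
  { assert (0 <= (/ INR m) ^ 2 <= 1) by (split; [apply pow2_ge_0|simpl; nra]).
    simpl in *. nra. }
  rewrite <- Rinv_1. apply Rinv_le_contravar; [lra|].
  apply Rle_trans with (2 * INR m * (/ INR m / 2)); [right; field; lra|].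
  apply Rmult_le_compat_l; lra. }
destruct (Rle_dec (Rabs v) v0) as [Hc|Hc]; [specialize (B v Hc); lra|].
replace (sqwave m v) with (sqwave m (Rabs v))
  by (unfold Rabs; destruct (Rcase_abs v); auto using sqwave_neg).
set (y := Rabs v) in *.
assert (B0 : Rabs (sqwave m v0) <= 1).
{ apply B. unfold v0. rewrite Rabs_pos_eq; lra. }
assert (H : Rabs (sqwave m y - sqwave m v0) <= INR m * (y - v0)).
{ apply (lipschitz_bound (sqwave m) _ (INR m) v0 y ltac:(lra) (fun x _ => is_derive_sqwave m x)).
  intros x _. apply Rle_trans with (1 := psum_abs _ _).
  apply Rle_trans with (psum (fun _ => 1) m).
  - apply psum_le. intros k _. rewrite Rabs_mult, pow_1_abs, Rmult_1_l.
    apply Rabs_le, SIN_bound.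
  - right. clear. induction m; [reflexivity|]. cbn [psum]. now rewrite IHm, S_INR. }
assert (INR m * (y - v0) <= 1).
{ apply Rle_trans with (INR m * / INR m); [|right; field; lra].
  apply Rmult_le_compat_l; unfold v0 in *; lra. }
apply Rabs_le_between in H. apply Rabs_le_between in B0. apply Rabs_le. lra.
Qed.

Lemma cos_odd_mult_even_shift k J v :
  cos ((2 * INR k + 1) * (2 * INR J * PI + v)) = cos ((2 * INR k + 1) * v).
Proof.
rewrite <- (cos_period ((2 * INR k + 1) * v) ((2 * k + 1) * J)). f_equal.
rewrite mult_INR, plus_INR, mult_INR. simpl INR. ring.
Qed.

Lemma sqwave_even_shift m J v : sqwave m (2 * INR J * PI + v) = sqwave m v.
Proof.
apply psum_ext. intros k _. now rewrite cos_odd_mult_even_shift.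
Qed.

(** An odd multiple of [PI] reverses the sign of every cosine. The upper level of the wave is thus
    [2 * leibniz m] already for finite [m], up to the same error as the lower level. *)
Lemma sqwave_odd_shift m J v :
  sqwave m ((2 * INR J + 1) * PI + v) = 2 * leibniz m - sqwave m v.
Proof.
unfold sqwave, leibniz. rewrite <- psum_scal, <- psum_minus.
apply psum_ext. intros k _.
replace ((2 * INR J + 1) * PI + v) with (2 * INR J * PI + (v + PI)) by ring.
rewrite cos_odd_mult_even_shift.
replace ((2 * INR k + 1) * (v + PI)) with ((2 * INR k + 1) * v + PI + 2 * INR k * PI) by ring.
rewrite cos_period, neg_cos. assert (H := two_INR_plus_1_pos k). field. lra.
Qed.

(** The end pieces hold the points where [sqwave] is merely bounded, or where [1 / y] is large; the
    middle piece is where it decays with [m]. *)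
Lemma three_piece_bound (f df : R -> R) (a b d B1 B2 B3 : R) :
  0 < d -> a + d <= b - d ->
  (forall x, a <= x <= b -> is_derive f x (df x)) ->
  (forall x, a <= x <= a + d -> Rabs (df x) <= B1) ->
  (forall x, a + d <= x <= b - d -> Rabs (df x) <= B2) ->
  (forall x, b - d <= x <= b -> Rabs (df x) <= B3) ->
  Rabs (f b - f a) <= B1 * d + B2 * (b - a) + B3 * d.
Proof.
intros Hd Hab Hf H1 H2 H3.
assert (E1 : Rabs (f (a + d) - f a) <= B1 * (a + d - a)).
{ apply lipschitz_bound with df; try lra; intros; [apply Hf|apply H1]; lra. }
assert (E2 : Rabs (f (b - d) - f (a + d)) <= B2 * (b - d - (a + d))).
{ apply lipschitz_bound with df; try lra; intros; [apply Hf|apply H2]; lra. }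
assert (E3 : Rabs (f b - f (b - d)) <= B3 * (b - (b - d))).
{ apply lipschitz_bound with df; try lra; intros; [apply Hf|apply H3]; lra. }
assert (0 <= B2) by (apply Rle_trans with (2 := H2 (a + d) ltac:(lra)); apply Rabs_pos).
apply Rabs_le_between in E1. apply Rabs_le_between in E2. apply Rabs_le_between in E3.
assert (B2 * (b - d - (a + d)) <= B2 * (b - a)) by (apply Rmult_le_compat_l; lra).
apply Rabs_le. lra.
Qed.

Lemma Cin_sum_first_quarter : is_lim_seq (fun m => Cin_sum m (PI / 2)) 0.
Proof.
assert (HP := PI2_3_2).
apply is_lim_seq_0_eps. intros d Hd.
assert (Hs : 0 < sin d) by (apply sin_gt_0; lra).
exists (/ (2 * sin d) * / d * (PI / 2)). intros m Hm.
assert (Hm' := lt_0_INR m Hm).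
assert (E0 : Cin_sum m 0 = 0).
{ apply psum_eq0. intros k _. rewrite Rmult_0_r, Cin_0. ring. }
replace (Cin_sum m (PI / 2)) with (Cin_sum m (PI / 2) - Cin_sum m 0) by lra.
replace (4 * d + / (2 * sin d) * / d * (PI / 2) / INR m) with
  (2 * d + / (2 * INR m * sin d) * / d * (PI / 2 - 0) + 2 * d) by (field; lra).
assert (D : forall x, 0 < x -> Rabs (sqwave m x / x) = Rabs (sqwave m x) * / x).
{ intros x Hx. unfold Rdiv. rewrite Rabs_mult, (Rabs_pos_eq (/ x)); auto.
  left; now apply Rinv_0_lt_compat. }
apply three_piece_bound with (fun y => sqwave m y / y); try lra.
- intros; apply is_derive_Cin_sum.
- intros x Hx. destruct (Req_dec x 0) as [->|Hx0].
  + rewrite sqwave_0. unfold Rdiv. rewrite Rmult_0_l, Rabs_R0. lra.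
  + rewrite D by lra. assert (H := sqwave_le_linear m x ltac:(lra)).
    apply Rle_trans with (x * / x).
    * apply Rmult_le_compat_r; auto. left; apply Rinv_0_lt_compat; lra.
    * rewrite Rinv_r; lra.
- intros x Hx. rewrite D by lra.
  apply Rmult_le_compat; [apply Rabs_pos|left; apply Rinv_0_lt_compat; lra| |].
  + apply sqwave_decay_away; auto; try lra. rewrite Rabs_pos_eq; lra.
  + apply Rinv_le_contravar; lra.
- intros x Hx. rewrite D by lra.
  assert (H := sqwave_bounded m x Hm ltac:(rewrite Rabs_pos_eq; lra)).
  replace 2 with (2 * 1) by ring.
  apply Rmult_le_compat; [apply Rabs_pos|left; apply Rinv_0_lt_compat; lra|auto|].
  rewrite <- Rinv_1. apply Rinv_le_contravar; lra.
Qed.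

Lemma sqwave_half_period_lim (f df : nat -> R -> R) :
  (forall m v, - (PI / 2) <= v <= PI / 2 -> is_derive (f m) v (df m v)) ->
  (forall m v, - (PI / 2) <= v <= PI / 2 -> Rabs (df m v) <= Rabs (sqwave m v)) ->
  is_lim_seq (fun m => f m (PI / 2) - f m (- (PI / 2))) 0.
Proof.
intros Hf Hd. assert (HP := PI2_3_2).
apply is_lim_seq_0_eps. intros d Hd0.
assert (Hs : 0 < sin d) by (apply sin_gt_0; lra).
exists (/ (2 * sin d) * PI). intros m Hm.
assert (Hm' := lt_0_INR m Hm).
replace (4 * d + / (2 * sin d) * PI / INR m) with
  (2 * d + / (2 * INR m * sin d) * (PI / 2 - - (PI / 2)) + 2 * d) by (field; lra).
apply three_piece_bound with (df m); try lra.
- intros; apply Hf; lra.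
- intros x Hx. apply Rle_trans with (1 := Hd m x ltac:(lra)).
  apply sqwave_bounded; auto. apply Rabs_le; lra.
- intros x Hx. apply Rle_trans with (1 := Hd m x ltac:(lra)).
  apply sqwave_decay_away; auto; try lra. apply Rabs_le; lra.
- intros x Hx. apply Rle_trans with (1 := Hd m x ltac:(lra)).
  apply sqwave_bounded; auto. apply Rabs_le; lra.
Qed.

(** One plateau of the wave, centred at [t]: the level [c m] integrates against [dy / y] to the
    logarithm, and the deviation from it is [sqwave] itself up to sign, which is small. The
    condition on [t] gives [1 / (t + v) <= 1]. *)
Lemma Cin_sum_half_period (t : R) (c s : nat -> R) :
  PI <= t ->
  (forall m v, sqwave m (t + v) = c m + s m * sqwave m v) ->
  (forall m, Rabs (s m) = 1) ->
  is_lim_seq (fun m => Cin_sum m (t + PI / 2) - Cin_sum m (t + - (PI / 2))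
     - c m * ln ((t + PI / 2) / (t + - (PI / 2)))) 0.
Proof.
intros Ht Hc Hs. assert (HP := PI2_3_2).
apply is_lim_seq_ext with (fun m =>
  (fun v => Cin_sum m (t + v) - c m * ln (t + v)) (PI / 2) -
  (fun v => Cin_sum m (t + v) - c m * ln (t + v)) (- (PI / 2))).
{ intros m. simpl. rewrite ln_div by lra. ring. }
apply (sqwave_half_period_lim (fun m v => Cin_sum m (t + v) - c m * ln (t + v))
        (fun m v => s m * sqwave m v / (t + v))).
- intros m v Hv.
  replace (s m * sqwave m v / (t + v)) with
    (sqwave m (t + v) / (t + v) - c m * / (t + v)) by (rewrite Hc; field; lra).
  apply (is_derive_minus (fun v => Cin_sum m (t + v)) (fun v => c m * ln (t + v))).
  + replace (sqwave m (t + v) / (t + v)) with (1 * (sqwave m (t + v) / (t + v))) by ring.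
    apply (is_derive_comp (Cin_sum m) (fun v => t + v)); [apply is_derive_Cin_sum|].
    auto_derive; auto.
  + auto_derive; [lra|]. field. lra.
- intros m v Hv. unfold Rdiv. rewrite !Rabs_mult, Hs, Rmult_1_l.
  rewrite (Rabs_pos_eq (/ (t + v))) by (left; apply Rinv_0_lt_compat; lra).
  assert (/ (t + v) <= 1) by (rewrite <- Rinv_1; apply Rinv_le_contravar; lra).
  assert (H' := Rabs_pos (sqwave m v)). nra.
Qed.

(** The integral of [dy / y] over the first [K] upper plateaus, whose ends are [(2i + 1/2) PI] and
    [(2i + 3/2) PI]. *)
Definition log_ratio_sum (K : nat) : R :=
  psum (fun i => ln ((INR i + 3 / 4) / (INR i + 1 / 4))) K.

Lemma Cin_sum_lim K :
  is_lim_seq (fun m => Cin_sum m ((2 * INR K + 1 / 2) * PI) - 2 * leibniz m * log_ratio_sum K) 0.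
Proof.
induction K as [|K IH].
- apply is_lim_seq_ext with (2 := Cin_sum_first_quarter).
  intros m. unfold log_ratio_sum; simpl.
  replace ((2 * 0 + 1 / 2) * PI) with (PI / 2) by field. ring.
- assert (HP := PI_RGT_0). assert (HK := pos_INR K).
  (* A full period is added: [H1] is the upper plateau, which produces the new logarithm, and [H2]
     the lower one, which contributes nothing in the limit. *)
  assert (H1 := Cin_sum_half_period ((2 * INR K + 1) * PI) (fun m => 2 * leibniz m) (fun _ => -1)
    ltac:(nra) ltac:(intros; rewrite sqwave_odd_shift; ring)
    ltac:(intros; rewrite Rabs_left; lra)).
  assert (H2 := Cin_sum_half_period (2 * INR (S K) * PI) (fun m => 0) (fun _ => 1)
    ltac:(rewrite S_INR; nra) ltac:(intros; rewrite sqwave_even_shift; ring)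
    ltac:(intros; apply Rabs_R1)).
  assert (H := is_lim_seq_plus' _ _ _ _ (is_lim_seq_plus' _ _ _ _ IH H1) H2).
  rewrite !Rplus_0_r in H. apply is_lim_seq_ext with (2 := H).
  intros m. cbv beta. unfold log_ratio_sum; cbn [psum]. rewrite S_INR.
  replace ((2 * INR K + 1) * PI + PI / 2) with ((2 * INR K + 3 / 2) * PI) by field.
  replace ((2 * INR K + 1) * PI + - (PI / 2)) with ((2 * INR K + 1 / 2) * PI) by field.
  replace (2 * (INR K + 1) * PI + - (PI / 2)) with ((2 * INR K + 3 / 2) * PI) by field.
  replace (2 * (INR K + 1) * PI + PI / 2) with ((2 * (INR K + 1) + 1 / 2) * PI) by field.
  replace ((2 * INR K + 3 / 2) * PI / ((2 * INR K + 1 / 2) * PI)) with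
    ((INR K + 3 / 4) / (INR K + 1 / 4)) by (field; lra).
  ring.
Qed.

Lemma leibniz_lim : is_lim_seq leibniz (PI / 4).
Proof.
apply is_lim_seq_incr_1.
apply is_lim_seq_ext with (fun n => sum_f_R0 (tg_alt PI_tg) n).
{ intros n. rewrite <- sum_n_Reals, psum_sum_n. apply psum_ext.
  intros k _. unfold tg_alt, PI_tg. rewrite plus_INR, mult_INR. reflexivity. }
apply is_lim_seq_Reals. rewrite <- Alt_PI_eq. unfold Alt_PI.
destruct exist_PI as [l Hl]. simpl.
replace (4 * l / 4) with l by field. exact Hl.
Qed.

Lemma inv_odd_square_sum m : psum (fun k => / (2 * INR k + 1) ^ 2) m <= 2.
Proof.
destruct m as [|m]; [simpl; lra|].
(* The strengthened bound telescopes, because [(2m + 3)^2 >= (m + 1) (m + 2)]. *)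
assert (H : psum (fun k => / (2 * INR k + 1) ^ 2) (S m) <= 2 - / INR (S m)).
{ induction m as [|m IH]; [simpl; apply Rminus_le; field_simplify; lra|].
  change (psum (fun k => / (2 * INR k + 1) ^ 2) (S m) + / (2 * INR (S m) + 1) ^ 2
          <= 2 - / INR (S (S m))).
  assert (Hm := pos_INR m). rewrite !S_INR in *.
  assert (/ (2 * (INR m + 1) + 1) ^ 2 <= / ((INR m + 1) * (INR m + 1 + 1))).
  { apply Rinv_le_contravar; [nra|simpl; nra]. }
  assert (/ ((INR m + 1) * (INR m + 1 + 1)) = / (INR m + 1) - / (INR m + 1 + 1)) by (field; lra).
  lra. }
assert (0 < / INR (S m)) by (apply Rinv_0_lt_compat, lt_0_INR; lia). lra.
Qed.

Definition alt_log_sum (m : nat) : R :=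
  psum (fun k => (-1) ^ k * ln (2 * INR k + 1) / (2 * INR k + 1)) m.

(** The error of the [k]-th [Cin] is at most [2 / ((2k+1) Y)] and its weight is [1 / (2k+1)], so the
    total is controlled by inverse odd squares. The point is uniformity in [m]. *)
Lemma Cin_sum_asymptotic m Y : 0 < Y ->
  Rabs (Cin_sum m Y - alt_log_sum m - leibniz m * (ln Y + euler_gamma)) <= 4 / Y.
Proof.
intros HY.
replace (Cin_sum m Y - alt_log_sum m - leibniz m * (ln Y + euler_gamma)) with
  (psum (fun k => (-1) ^ k / (2 * INR k + 1) *
     (Cin ((2 * INR k + 1) * Y) - ln ((2 * INR k + 1) * Y) - euler_gamma)) m).
- apply Rle_trans with (1 := psum_abs _ _).
  apply Rle_trans with (psum (fun k => 2 / Y * / (2 * INR k + 1) ^ 2) m).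
  + apply psum_le. intros k _. assert (H := two_INR_plus_1_pos k).
    assert (H' := Rinv_0_lt_compat _ H).
    unfold Rdiv at 1. rewrite !Rabs_mult, pow_1_abs, Rmult_1_l, (Rabs_pos_eq (/ _)) by lra.
    assert (HC := Cin_asymptotic ((2 * INR k + 1) * Y) ltac:(nra)).
    replace (2 / Y * / (2 * INR k + 1) ^ 2) with (/ (2 * INR k + 1) * (2 / ((2 * INR k + 1) * Y)))
      by (field; lra).
    apply Rmult_le_compat_l; lra.
  + rewrite psum_scal. replace (4 / Y) with (2 / Y * 2) by (field; lra).
    apply Rmult_le_compat_l; [left; apply Rdiv_lt_0_compat; lra|].
    apply inv_odd_square_sum.
- unfold Cin_sum, alt_log_sum, leibniz. rewrite (Rmult_comm (psum _ m)), <- psum_scal, <- !psum_minus.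
  apply psum_ext. intros k _. assert (H := two_INR_plus_1_pos k).
  rewrite ln_mult by lra. field. lra.
Qed.

(** A double limit: [K] is fixed first, so large that the uniform error [4 / Y] and the distance to
    [s] are both small; only then does [m] tend to infinity, with that [K]. Convergence of
    [alt_log_sum] comes out of the same argument. *)
Lemma alt_log_sum_lim (s : R) :
  is_lim_seq (fun K => PI / 4 * (2 * log_ratio_sum K - ln ((2 * INR K + 1 / 2) * PI) - euler_gamma)) s ->
  is_lim_seq alt_log_sum s.
Proof.
intros Hs. assert (HP := PI_RGT_0).
apply is_lim_seq_spec. intros eps. assert (He := cond_pos eps).
apply is_lim_seq_spec in Hs.
assert (He4 : 0 < eps / 4) by lra.
destruct (Hs (mkposreal _ He4)) as [K1 HK1]. simpl in HK1.
assert (HI := proj2 (is_lim_seq_spec _ _) is_lim_seq_inv_INR).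
assert (He5 : 0 < eps / 16) by lra.
destruct (HI (mkposreal _ He5)) as [K2 HK2]. simpl in HK2.
set (K := (K1 + K2 + 1)%nat). specialize (HK1 K ltac:(lia)). specialize (HK2 K ltac:(lia)).
assert (HKp : 0 < INR K) by (apply lt_0_INR; lia).
set (Y := (2 * INR K + 1 / 2) * PI) in *.
assert (HY : INR K <= Y) by (assert (H := PI2_1); unfold Y; nra).
assert (B : 4 / Y <= eps / 4).
{ rewrite Rminus_0_r, Rabs_pos_eq in HK2 by (left; now apply Rinv_0_lt_compat).
  assert (/ Y <= / INR K) by (apply Rinv_le_contravar; lra). unfold Rdiv. lra. }
set (u := fun m => (2 * log_ratio_sum K - ln Y - euler_gamma) * leibniz m
                   + (Cin_sum m Y - 2 * leibniz m * log_ratio_sum K)).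
assert (Hu : is_lim_seq u (PI / 4 * (2 * log_ratio_sum K - ln Y - euler_gamma))).
{ replace (PI / 4 * (2 * log_ratio_sum K - ln Y - euler_gamma)) with
    ((2 * log_ratio_sum K - ln Y - euler_gamma) * (PI / 4) + 0) by ring.
  apply is_lim_seq_plus'; [|apply Cin_sum_lim].
  apply (is_lim_seq_scal_l leibniz _ (PI / 4)), leibniz_lim. }
apply is_lim_seq_spec in Hu. destruct (Hu (mkposreal _ He4)) as [M HM]. simpl in HM.
exists M. intros m Hm. specialize (HM m Hm).
assert (HA := Cin_sum_asymptotic m Y ltac:(lra)).
unfold u in HM. apply Rabs_def2 in HM. apply Rabs_def2 in HK1. apply Rabs_le_between in HA.
apply Rabs_def1; lra.
Qed.

(** * The Gamma function at 1/4 *)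

Notation is_RInt_0_infty f l :=
  (is_RInt_gen f (at_right 0) (Rbar_locally p_infty) l) (only parsing).

Lemma filter_prod_0_infty (P : R -> Prop) :
  (forall t, 0 < t -> P t) ->
  filter_prod (at_right 0) (Rbar_locally p_infty) (fun ab =>
    forall t, Rmin (fst ab) (snd ab) <= t <= Rmax (fst ab) (snd ab) -> P t).
Proof.
intros HP. apply Filter_prod with (fun x => 0 < x) (fun y => 0 < y).
- exists (mkposreal 1 Rlt_0_1). intros; auto.
- exists 0; auto.
- intros x y Hx Hy t Ht. simpl in Ht. apply HP.
  apply Rlt_le_trans with (2 := proj1 Ht). now apply Rmin_pos.
Qed.

Lemma is_RInt_0_infty_ext (f g : R -> R) l :
  (forall t, 0 < t -> f t = g t) -> is_RInt_0_infty f l -> is_RInt_0_infty g l.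
Proof.
intros H. apply is_RInt_gen_ext.
apply filter_imp with (2 := filter_prod_0_infty (fun t => f t = g t) H).
intros ab Hab t Ht. apply Hab. lra.
Qed.

Lemma is_RInt_0_infty_le (f g : R -> R) lf lg :
  (forall t, 0 < t -> 0 <= f t <= g t) ->
  is_RInt_0_infty f lf -> is_RInt_0_infty g lg -> lf <= lg.
Proof.
intros H Hf Hg. apply Rle_trans with (1 := Rle_abs _).
apply (RInt_gen_norm (Fa := at_right 0) (Fb := Rbar_locally p_infty) f g lf lg); auto.
- apply Filter_prod with (fun x => x < 1) (fun y => 1 < y).
  + exists (mkposreal 1 Rlt_0_1). intros y Hy _. change (Rabs (y - 0) < 1) in Hy.
    apply Rabs_def2 in Hy. lra.
  + exists 1; auto.
  + intros x y Hx Hy. simpl. lra.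
- apply filter_imp with (2 := filter_prod_0_infty (fun t => 0 <= f t <= g t) H).
  intros [x y] Hab t Ht. simpl in *.
  assert (Q := Hab t). rewrite Rmin_left, Rmax_right in Q by lra.
  change (Rabs (f t) <= g t). rewrite Rabs_pos_eq; apply Q; lra.
Qed.

Lemma is_RInt_0_infty_derive (F dF : R -> R) la lb :
  (forall t, 0 < t -> is_derive F t (dF t)) ->
  (forall t, 0 < t -> continuous dF t) ->
  filterlim F (at_right 0) (locally la) ->
  filterlim F (Rbar_locally p_infty) (locally lb) ->
  is_RInt_0_infty dF (lb - la).
Proof.
intros HF HdF Ha Hb.
apply is_RInt_0_infty_ext with (Derive F).
{ intros t Ht. apply is_derive_unique; auto. }
apply is_RInt_gen_Derive; auto; try apply filter_prod_0_infty.
- intros t Ht. eexists. now apply HF.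
- intros t Ht. apply continuous_ext_loc with dF; [|now apply HdF].
  exists (mkposreal t Ht). intros y Hy. change (Rabs (y - t) < t) in Hy.
  apply Rabs_def2 in Hy. symmetry. apply is_derive_unique, HF. lra.
Qed.

(** For a nonnegative integrand, enlarging [[x, y]] increases the integral, so the supremum over all
    such intervals is the limit. *)
Lemma ex_RInt_0_infty_bounded (f : R -> R) (M : R) :
  (forall t, 0 < t -> continuous f t) ->
  (forall t, 0 < t -> 0 <= f t) ->
  (forall x y, 0 < x <= y -> RInt f x y <= M) ->
  exists l, is_RInt_0_infty f l.
Proof.
intros Hc Hp HM.
assert (Hex : forall x y, 0 < x -> 0 < y -> ex_RInt f x y).
{ intros x y Hx Hy. apply (ex_RInt_continuous (V := R_CompleteNormedModule)).
  intros z Hz. apply Hc. apply Rlt_le_trans with (2 := proj1 Hz). now apply Rmin_pos. }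
set (E := fun r => exists x y, 0 < x <= y /\ r = RInt f x y).
destruct (completeness E) as [l [Hub Hl]].
- exists M. intros r [x [y [H ->]]]. auto.
- exists (RInt f 1 1), 1, 1. split; [lra|reflexivity].
- exists l. intros P [eps HP].
  assert (Hw : exists x y, 0 < x <= y /\ l - eps < RInt f x y).
  { apply NNPP. intros Hn.
    assert (l <= l - eps); [|assert (He := cond_pos eps); lra].
    apply Hl. intros r [x [y [H ->]]]. apply Rnot_lt_le. intros Hlt.
    apply Hn. exists x, y. auto. }
  destruct Hw as [x0 [y0 [H0 Hlt]]].
  apply Filter_prod with (fun x => 0 < x < x0) (fun y => y0 < y).
  + exists (mkposreal x0 (proj1 H0)). intros y Hy Hy0. change (Rabs (y - 0) < x0) in Hy.
    apply Rabs_def2 in Hy. lra.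
  + exists y0; auto.
  + intros x y Hx Hy. simpl. exists (RInt f x y). split.
    * apply (RInt_correct (V := R_CompleteNormedModule)), Hex; lra.
    * apply HP. change (Rabs (RInt f x y - l) < eps).
      assert (U : RInt f x y <= l) by (apply Hub; exists x, y; split; [lra|reflexivity]).
      assert (C1 := RInt_Chasles f x x0 y (Hex x x0 ltac:(lra) ltac:(lra)) (Hex x0 y ltac:(lra) ltac:(lra))).
      assert (C2 := RInt_Chasles f x0 y0 y (Hex x0 y0 ltac:(lra) ltac:(lra)) (Hex y0 y ltac:(lra) ltac:(lra))).
      change (RInt f x x0 + RInt f x0 y = RInt f x y) in C1.
      change (RInt f x0 y0 + RInt f y0 y = RInt f x0 y) in C2.
      assert (0 <= RInt f x x0) by (apply RInt_ge_0; [lra|apply Hex; lra|intros; apply Hp; lra]).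
      assert (0 <= RInt f y0 y) by (apply RInt_ge_0; [lra|apply Hex; lra|intros; apply Hp; lra]).
      apply Rabs_def1; assert (He := cond_pos eps); lra.
Qed.

Definition gamma_integrand (a t : R) : R := Rpower t (a - 1) * exp (- t).

Definition is_Gamma (a l : R) : Prop := is_RInt_0_infty (gamma_integrand a) l.

Lemma Gamma_is_Gamma a l : is_Gamma a l -> Gamma a = l.
Proof. intros H. apply is_RInt_gen_unique. exact H. Qed.

Lemma gamma_integrand_pos a t : 0 < gamma_integrand a t.
Proof. apply Rmult_lt_0_compat; apply exp_pos. Qed.

Lemma gamma_integrand_mul a b t : 0 < t ->
  gamma_integrand (a + b) t = Rpower t b * gamma_integrand a t.
Proof.
intros Ht. unfold gamma_integrand. rewrite <- Rmult_assoc, <- Rpower_plus.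
do 2 f_equal. ring.
Qed.

Lemma continuous_gamma_integrand a t : 0 < t -> continuous (gamma_integrand a) t.
Proof.
intros Ht. apply (ex_derive_continuous (gamma_integrand a)).
unfold gamma_integrand, Rpower. auto_derive. auto.
Qed.

Lemma gamma_boundary_0 a : 0 < a ->
  filterlim (gamma_integrand (a + 1)) (at_right 0) (locally 0).
Proof.
intros Ha. apply filterlim_locally. intros eps.
assert (Hd : 0 < Rpower eps (/ a)) by apply exp_pos.
exists (mkposreal _ Hd). intros t Ht Ht0. change (Rabs (t - 0) < Rpower eps (/ a)) in Ht.
change (Rabs (gamma_integrand (a + 1) t - 0) < eps).
assert (Hp := gamma_integrand_pos (a + 1) t).
rewrite Rminus_0_r, Rabs_pos_eq in * by lra.
unfold gamma_integrand. replace (a + 1 - 1) with a by ring.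
assert (exp (- t) <= 1).
{ rewrite <- exp_0. destruct (Req_dec t 0) as [->|]; [rewrite Ropp_0; lra|].
  left. apply exp_increasing. lra. }
assert (Rpower t a < eps).
{ replace (pos eps) with (Rpower (Rpower eps (/ a)) a).
  - unfold Rpower at 1 2. apply exp_increasing. apply Rmult_lt_compat_l; auto.
    apply ln_increasing; auto.
  - rewrite Rpower_mult, Rinv_l by lra. apply Rpower_1, cond_pos. }
assert (0 < Rpower t a) by apply exp_pos.
assert (He := exp_pos (- t)). nra.
Qed.

Lemma gamma_boundary_infty a : 0 < a ->
  filterlim (gamma_integrand (a + 1)) (Rbar_locally p_infty) (locally 0).
Proof.
(* [C] is the maximum of [t^a exp (- t / 2)], attained at [t = 2a]; hence the scaling in the tangent
   bound for [ln (t / (2 * a))] below. *)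
intros Ha. set (C := exp (a * ln (2 * a) - a)).
assert (HC : 0 < C) by apply exp_pos.
apply filterlim_locally. intros eps. assert (He := cond_pos eps).
exists (2 * C / eps). intros t Ht.
assert (0 < 2 * C / eps) by (apply Rdiv_lt_0_compat; lra).
change (Rabs (gamma_integrand (a + 1) t - 0) < eps).
rewrite Rminus_0_r, Rabs_pos_eq by (left; apply gamma_integrand_pos).
unfold gamma_integrand. replace (a + 1 - 1) with a by ring.
assert (Hln := ln_le_sub1 (t / (2 * a)) ltac:(apply Rdiv_lt_0_compat; lra)).
rewrite ln_div in Hln by lra.
assert (H1 : a * ln t <= t / 2 + (a * ln (2 * a) - a)).
{ apply Rmult_le_compat_l with (r := a) in Hln; [|lra].
  replace (a * (t / (2 * a) - 1)) with (t / 2 - a) in Hln by (field; lra). lra. }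
apply Rle_lt_trans with (C * exp (- (t / 2))).
{ unfold Rpower, C. rewrite <- !exp_plus.
  assert (H2 : a * ln t + - t <= a * ln (2 * a) - a + - (t / 2)) by lra.
  destruct H2 as [H2|H2]; [left; now apply exp_increasing|rewrite H2; lra]. }
rewrite exp_Ropp. assert (H3 := exp_ineq1_le (t / 2)).
apply Rle_lt_trans with (C * / (t / 2)).
{ apply Rmult_le_compat_l; [lra|]. apply Rinv_le_contravar; lra. }
apply Rmult_lt_reg_r with (t / 2); [lra|].
rewrite Rmult_assoc, Rinv_l by lra.
apply Rmult_lt_compat_l with (r := eps) in Ht; auto.
replace (eps * (2 * C / eps)) with (2 * C) in Ht by (field; lra). lra.
Qed.

(** The integrand is the derivative of [t^a exp (- t)]. As one convergent integral with value [0],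
    the functional equation carries convergence both from [a] to [a + 1] and back. *)
Lemma is_Gamma_parts a : 0 < a ->
  is_RInt_0_infty (fun t => a * gamma_integrand a t - gamma_integrand (a + 1) t) 0.
Proof.
intros Ha. replace 0 with (0 - 0) at 2 by ring.
apply is_RInt_0_infty_derive with (gamma_integrand (a + 1)).
- intros t Ht. unfold gamma_integrand, Rpower. auto_derive; auto.
  assert (E : exp ((a - 1) * ln t) = exp (a * ln t) * / t).
  { replace ((a - 1) * ln t) with (a * ln t + - ln t) by ring.
    now rewrite exp_plus, exp_Ropp, exp_ln. }
  replace (a + 1 - 1) with a by ring. rewrite E. replace (a + 1 + -1) with a by ring.
  field. lra.
- intros t Ht. apply (continuous_minus (fun t => a * gamma_integrand a t) (gamma_integrand (a + 1))).
  + apply (continuous_mult (fun _ => a) (gamma_integrand a)).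
    * apply continuous_const.
    * now apply continuous_gamma_integrand.
  + now apply continuous_gamma_integrand.
- now apply gamma_boundary_0.
- now apply gamma_boundary_infty.
Qed.

Lemma is_Gamma_succ a l : 0 < a -> is_Gamma a l -> is_Gamma (a + 1) (a * l).
Proof.
intros Ha H.
assert (H1 := is_RInt_gen_minus _ _ _ _ (is_RInt_gen_scal _ a _ H) (is_Gamma_parts a Ha)).
replace (a * l) with (minus (scal a l) 0).
- apply is_RInt_0_infty_ext with (2 := H1). intros t Ht.
  unfold minus, plus, opp, scal; simpl; unfold mult; simpl. ring.
- unfold minus, plus, opp, scal; simpl; unfold mult; simpl. ring.
Qed.

Lemma is_Gamma_pred a l : 0 < a -> is_Gamma (a + 1) l -> is_Gamma a (l / a).
Proof.
intros Ha H.
assert (H1 := is_RInt_gen_scal _ (/ a) _ (is_RInt_gen_plus _ _ _ _ H (is_Gamma_parts a Ha))).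
replace (l / a) with (scal (/ a) (plus l 0)).
- apply is_RInt_0_infty_ext with (2 := H1). intros t Ht.
  unfold plus, scal; simpl; unfold mult; simpl. field. lra.
- unfold plus, scal; simpl; unfold mult; simpl. field. lra.
Qed.

Lemma is_Gamma_1 : is_Gamma 1 1.
Proof.
apply is_RInt_0_infty_ext with (fun t => exp (- t)).
{ intros t Ht. unfold gamma_integrand. replace (1 - 1) with 0 by ring.
  rewrite Rpower_O by auto. ring. }
replace 1 with (0 - - 1) by ring.
apply is_RInt_0_infty_derive with (fun t => - exp (- t)).
- intros t _. auto_derive; auto. ring.
- intros t _. apply (ex_derive_continuous (fun t => exp (- t))). auto_derive; auto.
- apply (filterlim_filter_le_1 (F := locally 0) (G := at_right 0)).
  + intros P [eps HP]. exists eps. intros; auto.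
  + replace (- 1) with ((fun t => - exp (- t)) 0) by (rewrite Ropp_0, exp_0; ring).
    apply (ex_derive_continuous (fun t => - exp (- t))). auto_derive; auto.
- apply filterlim_locally. intros eps. assert (He := cond_pos eps).
  exists (/ eps). intros t Ht. change (Rabs (- exp (- t) - 0) < eps).
  assert (Hi : 0 < / eps) by now apply Rinv_0_lt_compat.
  rewrite Rminus_0_r, Rabs_Ropp, Rabs_pos_eq by (left; apply exp_pos).
  rewrite exp_Ropp. assert (H := exp_ineq1_le t).
  rewrite <- (Rinv_inv eps). apply Rinv_lt_contravar; [|lra].
  apply Rmult_lt_0_compat; [auto|apply exp_pos].
Qed.

Lemma is_Gamma_fact n : is_Gamma (INR n + 1) (INR (fact n)).
Proof.
induction n.
- simpl. rewrite Rplus_0_l. apply is_Gamma_1.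
- rewrite fact_simpl, mult_INR, S_INR. apply is_Gamma_succ; auto.
  assert (H := pos_INR n). lra.
Qed.

(** Weighted AM-GM, from the tangent of [exp] at [b u] with [u = ln t]: in [b] times [E1] plus
    [1 - b] times [E2] the terms in [u] cancel. *)
Lemma Rpower_le_affine b t : 0 <= b <= 1 -> 0 < t -> Rpower t b <= (1 - b) + b * t.
Proof.
intros Hb Ht. rewrite <- (exp_ln t) at 2 by auto. unfold Rpower. set (u := ln t).
assert (E1 : exp (b * u) * (1 + (1 - b) * u) <= exp u).
{ replace (exp u) with (exp (b * u) * exp ((1 - b) * u))
    by (rewrite <- exp_plus; f_equal; ring).
  apply Rmult_le_compat_l; [left; apply exp_pos|apply exp_ineq1_le]. }
assert (E2 : exp (b * u) * (1 + - (b * u)) <= 1).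
{ replace 1 with (exp (b * u) * exp (- (b * u))) at 2
    by (rewrite <- exp_plus, <- exp_0; f_equal; ring).
  apply Rmult_le_compat_l; [left; apply exp_pos|apply exp_ineq1_le]. }
nra.
Qed.

Lemma Rpower_le_affine_scaled b c t : 0 <= b <= 1 -> 0 < c -> 0 < t ->
  Rpower t b <= Rpower c b * ((1 - b) + b * t / c).
Proof.
intros Hb Hc Ht.
assert (H := Rpower_le_affine b (t / c) Hb ltac:(apply Rdiv_lt_0_compat; auto)).
replace (Rpower t b) with (Rpower c b * Rpower (t / c) b).
- apply Rmult_le_compat_l; [left; apply exp_pos|].
  replace (b * t / c) with (b * (t / c)) by (field; lra). auto.
- rewrite Rpower_mult_distr; auto; [|apply Rdiv_lt_0_compat; auto].
  f_equal. field. lra.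
Qed.

(* Log-convexity of Gamma in multiplicative form, from weighted AM-GM under the integral. *)
Lemma is_Gamma_interpolation a b c l l1 :
  0 < a -> 0 <= b <= 1 -> 0 < c ->
  is_Gamma a l -> is_Gamma (a + b) l1 ->
  l1 <= Rpower c b * ((1 - b) * l + b / c * (a * l)).
Proof.
intros Ha Hb Hc Hl Hl1.
assert (Hs := is_Gamma_succ a l Ha Hl).
assert (HG := is_RInt_gen_scal _ (Rpower c b) _ (is_RInt_gen_plus _ _ _ _
   (is_RInt_gen_scal _ (1 - b) _ Hl) (is_RInt_gen_scal _ (b / c) _ Hs))).
apply (is_RInt_0_infty_le _ _ _ _) with (2 := Hl1) (3 := HG).
intros t Ht. split; [left; apply gamma_integrand_pos|].
rewrite !gamma_integrand_mul, Rpower_1 by auto.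
unfold plus, scal; simpl; unfold mult; simpl.
assert (H := Rpower_le_affine_scaled b c t Hb Hc Ht).
assert (Hp := gamma_integrand_pos a t).
replace (Rpower c b * ((1 - b) * gamma_integrand a t + b / c * (t * gamma_integrand a t))) with
 (Rpower c b * (1 - b + b * t / c) * gamma_integrand a t) by (field; lra).
apply Rmult_le_compat_r; lra.
Qed.

(** The integrand at [1/4] is unbounded near [0], so convergence is proved at [5/4] and pulled back
    by the functional equation. *)
Lemma ex_Gamma_quarter : exists l, is_Gamma (1 / 4) l.
Proof.
destruct (ex_RInt_0_infty_bounded (gamma_integrand (1 / 4 + 1)) 1) as [l Hl].
- intros; now apply continuous_gamma_integrand.
- intros; left; apply gamma_integrand_pos.
- intros x y Hxy.
  (* A primitive of the majorant obtained from [t^(1/4) <= 3/4 + t/4]. *)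
  set (G := fun t => - ((1 + t / 4) * exp (- t))).
  assert (HG : is_RInt (fun t => (3 / 4 + t / 4) * exp (- t)) x y (G y - G x)).
  { apply (is_RInt_derive G).
    - intros t _. unfold G. auto_derive; auto. field.
    - intros t _. apply (ex_derive_continuous (fun t => (3 / 4 + t / 4) * exp (- t))).
      auto_derive; auto. }
  apply Rle_trans with (G y - G x).
  + rewrite <- (is_RInt_unique _ _ _ _ HG). apply RInt_le; [lra| |now exists (G y - G x)|].
    * apply (ex_RInt_continuous (V := R_CompleteNormedModule)). intros t Ht.
      rewrite Rmin_left in Ht by lra. apply continuous_gamma_integrand. lra.
    * intros t Ht. unfold gamma_integrand. apply Rmult_le_compat_r; [left; apply exp_pos|].
      replace (1 / 4 + 1 - 1) with (1 / 4) by ring.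
      assert (H := Rpower_le_affine (1 / 4) t ltac:(lra) ltac:(lra)). lra.
  + unfold G. assert (H1 : 0 <= (1 + y / 4) * exp (- y)).
    { apply Rmult_le_pos; [lra|left; apply exp_pos]. }
    assert (H2 : (1 + x / 4) * exp (- x) <= 1).
    { rewrite exp_Ropp. assert (H := exp_ineq1_le x). apply Rle_div_l; lra. }
    lra.
- exists (l / (1 / 4)). apply is_Gamma_pred; [lra|exact Hl].
Qed.

(** The Pochhammer symbol of [1/4], that is [Gamma (n + 1/4) / Gamma (1/4)]. *)
Fixpoint rising_quarter (n : nat) : R :=
  match n with O => 1 | S k => (INR k + 1 / 4) * rising_quarter k end.

Lemma rising_quarter_pos n : 0 < rising_quarter n.
Proof.
induction n; simpl rising_quarter; [lra|].
apply Rmult_lt_0_compat; auto. assert (H := pos_INR n). lra.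
Qed.

Lemma is_Gamma_rising_quarter l n :
  is_Gamma (1 / 4) l -> is_Gamma (INR n + 1 / 4) (rising_quarter n * l).
Proof.
intros Hl. induction n.
- simpl. now rewrite Rplus_0_l, Rmult_1_l.
- rewrite S_INR. replace (INR n + 1 + 1 / 4) with (INR n + 1 / 4 + 1) by ring.
  cbn [rising_quarter]. rewrite Rmult_assoc. apply is_Gamma_succ; auto.
  assert (H := pos_INR n). lra.
Qed.

Lemma INR_fact_pos n : 0 < INR (fact n).
Proof. apply lt_0_INR, lt_O_fact. Qed.

(** Interpolation from [1/4] to [1] with [c = 1] bounds [Gamma 1 = 1] by a positive multiple of
    [Gamma (1/4)]. *)
Lemma Gamma_quarter_pos : 0 < Gamma (1 / 4).
Proof.
destruct ex_Gamma_quarter as [l Hl]. rewrite (Gamma_is_Gamma _ _ Hl).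
assert (H1 : is_Gamma (1 / 4 + 3 / 4) 1).
{ replace (1 / 4 + 3 / 4) with 1 by field. apply is_Gamma_1. }
assert (H := is_Gamma_interpolation (1 / 4) (3 / 4) 1 l 1
  ltac:(lra) ltac:(lra) ltac:(lra) Hl H1).
unfold Rpower in H. rewrite ln_1, Rmult_0_r, exp_0 in H. lra.
Qed.

(** Two interpolations: [n + 1] between [n + 1/4] and [n + 5/4] gives the lower bound, [n + 5/4]
    between [n + 1] and [n + 2] the upper one. The scale [c = n] makes them lose only the factors
    [1 + 3/(16 n)] and [1 + 1/(4 n)]. *)
Lemma ln_rising_quarter_asymptotic n : (0 < n)%nat ->
  Rabs (ln (rising_quarter n) - ln (INR (fact n)) + 3 / 4 * ln (INR n) + ln (Gamma (1 / 4)))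
    <= / INR n.
Proof.
intros Hn. apply lt_0_INR in Hn. assert (Hi := Rinv_0_lt_compat _ Hn).
assert (Hlp := Gamma_quarter_pos).
destruct ex_Gamma_quarter as [l Hl]. rewrite (Gamma_is_Gamma _ _ Hl) in *.
assert (Hp := rising_quarter_pos n). assert (Hf := INR_fact_pos n).
assert (Hq := is_Gamma_rising_quarter l n Hl).
assert (Hl1 : forall e, 0 < e <= 1 -> ln (1 + e / INR n) <= / INR n).
{ intros e He. assert (H := ln_le_sub1 (1 + e / INR n)).
  assert (0 <= e / INR n <= / INR n); [|lra].
  unfold Rdiv. split; [apply Rmult_le_pos; lra|nra]. }
apply Rabs_le. split.
- assert (H1 : is_Gamma (INR n + 1 / 4 + 3 / 4) (INR (fact n))).
  { replace (INR n + 1 / 4 + 3 / 4) with (INR n + 1) by field. apply is_Gamma_fact. }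
  assert (H := is_Gamma_interpolation (INR n + 1 / 4) (3 / 4) (INR n) _ _
     ltac:(lra) ltac:(lra) Hn Hq H1).
  replace (Rpower (INR n) (3 / 4) * _) with
    (Rpower (INR n) (3 / 4) * (rising_quarter n * (l * (1 + (3 / 16) / INR n)))) in H
    by (field; lra).
  assert (0 < 1 + 3 / 16 / INR n).
  { assert (0 < 3 / 16 / INR n) by (apply Rdiv_lt_0_compat; lra). lra. }
  apply ln_le in H; auto.
  rewrite !ln_mult in H; try (apply exp_pos); repeat apply Rmult_lt_0_compat; auto.
  unfold Rpower in H. rewrite ln_exp in H. assert (Q := Hl1 (3 / 16) ltac:(lra)). lra.
- assert (H1 : is_Gamma (INR n + 1 + 1 / 4) ((INR n + 1 / 4) * (rising_quarter n * l))).
  { replace (INR n + 1 + 1 / 4) with (INR n + 1 / 4 + 1) by field. apply is_Gamma_succ; [lra|auto]. }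
  assert (H := is_Gamma_interpolation (INR n + 1) (1 / 4) (INR n) _ _
     ltac:(lra) ltac:(lra) Hn (is_Gamma_fact n) H1).
  replace (Rpower (INR n) (1 / 4) * _) with
    (Rpower (INR n) (1 / 4) * (INR (fact n) * (1 + (1 / 4) / INR n))) in H
    by (field; lra).
  assert (0 < 1 + 1 / 4 / INR n).
  { assert (0 < 1 / 4 / INR n) by (apply Rdiv_lt_0_compat; lra). lra. }
  apply ln_le in H; [|repeat apply Rmult_lt_0_compat; auto; lra].
  rewrite !ln_mult in H; try (apply exp_pos); repeat apply Rmult_lt_0_compat; auto; try lra.
  unfold Rpower in H. rewrite ln_exp in H. assert (Q := Hl1 (1 / 4) ltac:(lra)).
  assert (ln (INR n) <= ln (INR n + 1 / 4)) by (apply ln_le; lra). lra.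
Qed.

Lemma ln_odd_even_prod_asymptotic n : (0 < n)%nat ->
  Rabs (ln PI + 2 * ln (odd_even_prod n) + ln (INR n)) <= / INR n.
Proof.
intros Hn. apply lt_0_INR in Hn. assert (Hi := Rinv_0_lt_compat _ Hn).
destruct (odd_even_prod_bounds n) as [H1 H2]. assert (Hw := odd_even_prod_pos n).
assert (HP := PI_RGT_0). set (w := odd_even_prod n) in *.
assert (Hw2 : 0 < w ^ 2) by now apply pow_lt.
assert (E : ln (PI * w ^ 2 * INR n) = ln PI + 2 * ln w + ln (INR n)).
{ simpl. rewrite Rmult_1_r, !ln_mult; repeat first [lra | apply Rmult_lt_0_compat]. }
rewrite <- E.
assert (Hx : 0 < PI * w ^ 2 * INR n) by (repeat first [lra | apply Rmult_lt_0_compat]).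
apply Rabs_le. split.
- apply Rle_trans with (2 := ln_ge_1_sub_inv _ Hx).
  assert (INR n / (INR n + 1) <= PI * w ^ 2 * INR n).
  { unfold Rdiv. rewrite Rmult_comm. apply Rmult_le_compat_r; lra. }
  assert (/ (PI * w ^ 2 * INR n) <= / (INR n / (INR n + 1))).
  { apply Rinv_le_contravar; auto. apply Rdiv_lt_0_compat; lra. }
  replace (/ (INR n / (INR n + 1))) with (1 + / INR n) in * by (field; lra). lra.
- assert (H := ln_le_sub1 _ Hx). lra.
Qed.

(** The product of the [(i + 1/4) (i + 3/4)] over [i < K] is [K!^2] times the two Wallis products;
    dividing by the square of the product of the [i + 1/4] leaves the ratio. This takes the place of
    the reflection formula linking [Gamma (1/4)] and [Gamma (3/4)]. *)
Lemma log_ratio_sum_closed_form K :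
  log_ratio_sum K = ln (odd_even_prod (2 * K)) + ln (odd_even_prod K)
    + 2 * ln (INR (fact K)) - 2 * ln (rising_quarter K).
Proof.
induction K as [|K IH].
- simpl. rewrite ln_1. unfold log_ratio_sum; simpl. ring.
- unfold log_ratio_sum in *. cbn [psum]. rewrite IH.
  replace (2 * S K)%nat with (S (S (2 * K))) by lia. cbn [odd_even_prod rising_quarter].
  rewrite fact_simpl.
  assert (HK := pos_INR K). assert (P1 := odd_even_prod_pos (2 * K)).
  assert (P2 := odd_even_prod_pos K). assert (P3 := INR_fact_pos K).
  assert (P4 := rising_quarter_pos K).
  replace (INR (2 * (2 * K) + 1)) with (4 * (INR K + 1 / 4))
    by (rewrite plus_INR, !mult_INR; simpl; field).
  replace (INR (2 * (2 * K) + 2)) with (2 * (2 * INR K + 1))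
    by (rewrite plus_INR, !mult_INR; simpl; field).
  replace (INR (2 * S (2 * K) + 1)) with (4 * (INR K + 3 / 4))
    by (rewrite plus_INR, mult_INR, (S_INR (2 * K)), mult_INR; simpl; field).
  replace (INR (2 * S (2 * K) + 2)) with (4 * (INR K + 1))
    by (rewrite plus_INR, mult_INR, (S_INR (2 * K)), mult_INR; simpl; field).
  replace (INR (2 * K + 1)) with (2 * INR K + 1) by (rewrite plus_INR, mult_INR; simpl; ring).
  replace (INR (2 * K + 2)) with (2 * (INR K + 1)) by (rewrite plus_INR, mult_INR; simpl; ring).
  rewrite mult_INR, (S_INR K).
  assert (L4 : ln 4 = 2 * ln 2).
  { replace 4 with (2 * 2) by ring. rewrite ln_mult by lra. ring. }
  assert (Q : forall x y, 0 < x -> 0 < y -> 0 < x / y) by (intros; now apply Rdiv_lt_0_compat).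
  assert (L : forall a b x y, 0 < a -> 0 < b -> 0 < x -> 0 < y ->
    ln (a * x / (b * y)) = ln a + ln x - ln b - ln y).
  { intros. rewrite ln_div, !ln_mult; try apply Rmult_lt_0_compat; auto. ring. }
  assert (E1 := L 4 2 (INR K + 1 / 4) (2 * INR K + 1) ltac:(lra) ltac:(lra) ltac:(lra) ltac:(lra)).
  assert (E2 := L 4 4 (INR K + 3 / 4) (INR K + 1) ltac:(lra) ltac:(lra) ltac:(lra) ltac:(lra)).
  assert (E3 := L 1 2 (2 * INR K + 1) (INR K + 1) ltac:(lra) ltac:(lra) ltac:(lra) ltac:(lra)).
  rewrite Rmult_1_l, ln_1 in E3. rewrite L4 in *.
  rewrite (ln_mult (_ * _)), (ln_mult (odd_even_prod (2 * K))), (ln_mult (odd_even_prod K)),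
    (ln_mult (INR K + 1)), (ln_mult (INR K + 1 / 4)), E1, E2, E3, ln_div;
    repeat first [lra | apply Q | apply Rmult_lt_0_compat].
Qed.

Lemma log_ratio_sum_lim :
  is_lim_seq (fun K => PI / 4 * (2 * log_ratio_sum K - ln ((2 * INR K + 1 / 2) * PI) - euler_gamma))
    (PI / 4 * (4 * ln (Gamma (1 / 4)) - 3 * ln PI - 2 * ln 2 - euler_gamma)).
Proof.
apply (is_lim_seq_scal_l _ (PI / 4) (4 * ln (Gamma (1 / 4)) - 3 * ln PI - 2 * ln 2 - euler_gamma)).
(* The logarithms of [K] cancel. The errors, in units of [1/K], are [1/2] and [1] from the Wallis
   products, [4] from [rising_quarter] and [1/4] from the shift in [2K + 1/2]. *)
apply is_lim_seq_sandwich with (fun K => 6 * / INR K).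
- replace (Finite 0) with (Rbar_mult 6 0) by (simpl; f_equal; ring).
  apply (is_lim_seq_scal_l (fun K => / INR K) 6 0), is_lim_seq_inv_INR.
- exists 1%nat. intros K HK. assert (HP := PI_RGT_0).
  assert (HK' : 0 < INR K) by (apply lt_0_INR; lia).
  assert (Hi := Rinv_0_lt_compat _ HK').
  rewrite log_ratio_sum_closed_form.
  assert (B1 := ln_odd_even_prod_asymptotic (2 * K) ltac:(lia)).
  assert (B2 := ln_odd_even_prod_asymptotic K ltac:(lia)).
  assert (B3 := ln_rising_quarter_asymptotic K ltac:(lia)).
  rewrite mult_INR in B1. replace (INR 2) with 2 in B1 by (simpl; ring).
  rewrite Rinv_mult, ln_mult in B1 by lra.
  replace ((2 * INR K + 1 / 2) * PI) with (2 * INR K * (1 + / 4 * / INR K) * PI) by (field; lra).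
  rewrite !ln_mult by (repeat first [lra | apply Rmult_lt_0_compat]).
  assert (U := ln_le_sub1 (1 + / 4 * / INR K) ltac:(lra)).
  assert (V : 0 <= ln (1 + / 4 * / INR K)) by (rewrite <- ln_1; apply ln_le; lra).
  apply Rabs_le_between in B1. apply Rabs_le_between in B2. apply Rabs_le_between in B3.
  apply Rabs_le. lra.
Qed.

(* Malmsten's series for [- L'(1)], [L] the Dirichlet [L]-function of the character mod 4. *)
Lemma alt_log_sum_value :
  is_lim_seq alt_log_sum (PI / 4 * (4 * ln (Gamma (1 / 4)) - 3 * ln PI - 2 * ln 2 - euler_gamma)).
Proof. apply alt_log_sum_lim, log_ratio_sum_lim. Qed.

(** * Stieltjes constants *)

Lemma is_series_psum f l : is_series f l <-> is_lim_seq (psum f) l.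
Proof.
split; intros H.
- apply is_lim_seq_incr_1. apply is_lim_seq_ext with (sum_n f).
  + intros n. apply psum_sum_n.
  + exact H.
- apply is_lim_seq_incr_1 in H. apply is_lim_seq_ext with (v := sum_n f) in H.
  + exact H.
  + intros n. symmetry. apply psum_sum_n.
Qed.

Lemma is_lim_seq_eq (u v : nat -> R) (a b : R) :
  (forall n, u n = v n) -> is_lim_seq u a -> is_lim_seq v b -> a = b.
Proof.
intros H Hu Hv. apply is_lim_seq_unique in Hu. apply is_lim_seq_unique in Hv.
rewrite (Lim_seq_ext _ _ H), Hv in Hu. now injection Hu.
Qed.

Lemma is_series_Re (f : nat -> C) (l : C) :
  is_series (K := C_AbsRing) (V := C_NormedModule) f l ->
  is_series (fun n => Re (f n)) (Re l).
Proof.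
intros H P [eps HP].
assert (E : forall n, sum_n (fun n => Re (f n)) n = Re (sum_n (G := C_NormedModule) f n)).
{ induction n; [now rewrite !sum_O|]. rewrite !sum_Sn, IHn. reflexivity. }
assert (HQ : locally l (fun z : C_NormedModule => P (Re z))).
{ apply (locally_le_locally_norm (K := C_AbsRing) (V := C_NormedModule)).
  exists eps. intros z Hz. apply HP.
  change (Rabs (Re z - Re l) < eps).
  apply Rle_lt_trans with (2 := Hz).
  replace (Re z - Re l) with (Re (z - l)%C) by reflexivity.
  apply Rle_trans with (2 := Rmax_Cmod (z - l)%C). apply Rmax_l. }
destruct (H _ HQ) as [N HN]. exists N. intros n Hn. rewrite E. now apply HN.
Qed.

Lemma Re_RpowC_real x s : Re (RpowC x (- RtoC s)%C) = Rpower x (- s).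
Proof.
unfold RpowC. simpl. rewrite Ropp_0, Rmult_0_l, cos_0. ring.
Qed.

Definition hurwitz_term (u e : R) (n : nat) : R := Rpower (INR n + u) (- (1 + e)).

Definition real_hurwitz (u e : R) : R := Series (hurwitz_term u e).

Section Stieltjes.

Variables (zeta : C -> R -> C) (g : nat -> R -> R).
Hypothesis Hzeta : is_hurwitz_zeta zeta.
Hypothesis Hg : is_stieltjes zeta g.

Lemma is_series_Re_zeta u e : 0 < u -> 0 < e ->
  is_series (hurwitz_term u e) (Re (zeta (RtoC (1 + e)) u)).
Proof.
intros Hu He. destruct (Hzeta u Hu) as [_ H].
assert (HS := is_series_Re _ _ (H (RtoC (1 + e)) ltac:(simpl; lra))).
revert HS. apply is_series_ext. intros n. apply Re_RpowC_real.
Qed.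

Lemma real_hurwitz_correct u e : 0 < u -> 0 < e ->
  is_lim_seq (psum (hurwitz_term u e)) (real_hurwitz u e).
Proof.
intros Hu He. apply is_series_psum, Series_correct.
eexists. now apply is_series_Re_zeta.
Qed.

Definition eps (k : nat) : R := / INR (S k).

Lemma eps_pos k : 0 < eps k <= 1.
Proof.
assert (H : 1 <= INR (S k)) by (apply (le_INR 1); lia).
unfold eps. split; [apply Rinv_0_lt_compat; lra|].
rewrite <- Rinv_1. apply Rinv_le_contravar; lra.
Qed.

Lemma eps_lim : is_lim_seq eps 0.
Proof. apply -> (is_lim_seq_incr_1 (fun n => / INR n)). apply is_lim_seq_inv_INR. Qed.

Lemma derive_eps_lim (f : R -> R) l : is_derive f 0 l ->
  is_lim_seq (fun k => (f (eps k) - f 0) / eps k) l.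
Proof.
intros H. apply is_derive_Reals in H. apply is_lim_seq_spec. intros e.
destruct (H e (cond_pos e)) as [d Hd].
destruct (proj2 (is_lim_seq_spec _ _) eps_lim d) as [N HN].
exists N. intros n Hn. specialize (HN n Hn). rewrite Rminus_0_r in HN.
assert (He := eps_pos n). specialize (Hd (eps n) ltac:(lra) HN).
now rewrite Rplus_0_l in Hd.
Qed.

(** Along [s = 1 + e] the real part of the Laurent expansion is a real power series in [e], and the
    limit is its derivative at [0]. *)
Lemma stieltjes_first_order u : 0 < u ->
  is_lim_seq (fun k => (real_hurwitz u (eps k) - / eps k - g 0%nat u) / eps k) (- g 1%nat u).
Proof.
intros Hu. destruct (Hg u Hu) as [d Hd].
set (a := fun p => (-1) ^ p / INR (fact p) * g p u).
assert (Hs : forall e, 0 < e < d -> is_pseries a e (real_hurwitz u e - / e)).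
{ intros e He. apply is_pseries_R.
  assert (Hb : ball (M := C_UniformSpace) (RtoC 1) d (RtoC (1 + e))).
  { split.
    - change (Rabs (1 + e - 1) < d). rewrite Rabs_pos_eq; lra.
    - change (Rabs (0 - 0) < d). rewrite Rminus_0_r, Rabs_R0. apply cond_pos. }
  assert (Hne : RtoC (1 + e) <> RtoC 1).
  { intros E. apply RtoC_inj in E. lra. }
  assert (H := is_series_Re _ _ (Hd _ Hb Hne)).
  replace (RtoC (1 + e) - RtoC 1)%C with (RtoC e) in H
    by (rewrite <- RtoC_minus; f_equal; ring).
  replace (real_hurwitz u e - / e) with (Re (zeta (RtoC (1 + e)) u - / RtoC e)%C).
  - revert H. apply is_series_ext. intros p.
    rewrite <- RtoC_pow, <- RtoC_mult. reflexivity.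
  - unfold real_hurwitz. rewrite (is_series_unique _ _ (is_series_Re_zeta u e Hu (proj1 He))).
    rewrite <- RtoC_inv by lra. reflexivity. }
(* Convergence at [e = d / 2] forces a radius of at least [d / 2]. *)
assert (Hr : Rbar_lt (Rabs 0) (CV_radius a)).
{ rewrite Rabs_R0. apply Rbar_lt_le_trans with (d / 2).
  - simpl. assert (H := cond_pos d). lra.
  - apply Rbar_not_lt_le. intros Hlt.
    assert (H := cond_pos d).
    apply (CV_disk_outside a (d / 2)).
    + rewrite Rabs_pos_eq by lra. exact Hlt.
    + apply ex_series_lim_0. eexists. apply is_pseries_R, Hs. lra. }
assert (HD := derive_eps_lim _ _ (is_derive_PSeries a 0 Hr)).
rewrite !PSeries_0 in HD.
replace (PS_derive a 0) with (- g 1%nat u) in HD.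
- apply is_lim_seq_ext_loc with (2 := HD).
  destruct (proj2 (is_lim_seq_spec _ _) eps_lim d) as [N HN].
  exists N. intros n Hn. specialize (HN n Hn). rewrite Rminus_0_r in HN.
  assert (He := eps_pos n). rewrite Rabs_pos_eq in HN by lra.
  rewrite (is_pseries_unique _ _ _ (Hs (eps n) ltac:(lra))).
  unfold a. simpl. field. lra.
- unfold PS_derive, a. simpl. field.
Qed.

Lemma stieltjes_zeroth_order u : 0 < u ->
  is_lim_seq (fun k => real_hurwitz u (eps k) - / eps k) (g 0%nat u).
Proof.
intros Hu.
apply is_lim_seq_ext with (fun k => g 0%nat u + eps k *
  ((real_hurwitz u (eps k) - / eps k - g 0%nat u) / eps k)).
- intros k. assert (H := eps_pos k). field. lra.
- replace (g 0%nat u) with (g 0%nat u + 0 * (- g 1%nat u)) at 1 by ring.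
  apply is_lim_seq_plus'; [apply is_lim_seq_const|].
  apply is_lim_seq_mult'; [apply eps_lim|now apply stieltjes_first_order].
Qed.

(** * The sum of the constants at [1/4] and [3/4] *)

Lemma Rpower_scale c x s : 0 < c -> 0 < x -> Rpower c s * Rpower (c * x) (- s) = Rpower x (- s).
Proof.
intros Hc Hx. rewrite <- Rpower_mult_distr, <- Rmult_assoc, <- Rpower_plus by auto.
rewrite Rplus_opp_r, Rpower_O by auto. ring.
Qed.

Lemma hurwitz_term_scale (c m i n : nat) (u v e : R) :
  0 < u -> 0 < v -> (0 < c)%nat -> INR m + u = INR c * (INR n + v) ->
  Rpower (INR c) (1 + e) * hurwitz_term u e m = hurwitz_term v e n.
Proof.
intros Hu Hv Hc E. unfold hurwitz_term. rewrite E.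
apply Rpower_scale; [now apply lt_0_INR|]. assert (H := pos_INR n). lra.
Qed.

(** The integers up to [4N], divided by [4], have offsets [1/4], [1/2], [3/4], [1]; those up to
    [2N], divided by [2], have offsets [1/2] and [1]. Subtracting leaves the two quarters. *)
Lemma psum_hurwitz_quarters e N :
  psum (hurwitz_term (1 / 4) e) N + psum (hurwitz_term (3 / 4) e) N =
  Rpower 4 (1 + e) * psum (hurwitz_term 1 e) (4 * N)
  - Rpower 2 (1 + e) * psum (hurwitz_term 1 e) (2 * N).
Proof.
induction N; [simpl; ring|].
replace (4 * S N)%nat with (S (S (S (S (4 * N))))) by lia.
replace (2 * S N)%nat with (S (S (2 * N))) by lia.
cbn [psum].
assert (Q : forall m v, 0 < v -> INR m + 1 = INR 4 * (INR N + v) ->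
   Rpower 4 (1 + e) * hurwitz_term 1 e m = hurwitz_term v e N).
{ intros m v Hv E. replace 4 with (INR 4) by (simpl; ring).
  apply hurwitz_term_scale; auto; try lra; lia. }
assert (D : forall m v, 0 < v -> INR m + 1 = INR 2 * (INR N + v) ->
   Rpower 2 (1 + e) * hurwitz_term 1 e m = hurwitz_term v e N).
{ intros m v Hv E. replace 2 with (INR 2) by (simpl; ring).
  apply hurwitz_term_scale; auto; try lra; lia. }
assert (Q0 := Q (4 * N)%nat (1 / 4) ltac:(lra) ltac:(rewrite mult_INR; simpl; field)).
assert (Q1 := Q (S (4 * N)) (1 / 2) ltac:(lra) ltac:(rewrite S_INR, mult_INR; simpl; field)).
assert (Q2 := Q (S (S (4 * N))) (3 / 4) ltac:(lra) ltac:(rewrite !(S_INR (S _)), S_INR, mult_INR; simpl; field)).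
assert (Q3 := Q (S (S (S (4 * N)))) 1 ltac:(lra) ltac:(rewrite S_INR, S_INR, (S_INR (4 * N)), mult_INR; simpl; field)).
assert (D0 := D (2 * N)%nat (1 / 2) ltac:(lra) ltac:(rewrite mult_INR; simpl; field)).
assert (D1 := D (S (2 * N)) 1 ltac:(lra) ltac:(rewrite S_INR, mult_INR; simpl; field)).
rewrite !Rmult_plus_distr_l, Q0, Q1, Q2, Q3, D0, D1. lra.
Qed.

Lemma real_hurwitz_quarters e : 0 < e ->
  real_hurwitz (1 / 4) e + real_hurwitz (3 / 4) e =
  (Rpower 4 (1 + e) - Rpower 2 (1 + e)) * real_hurwitz 1 e.
Proof.
intros He.
assert (H1 := real_hurwitz_correct 1 e ltac:(lra) He).
assert (HL := is_lim_seq_plus' _ _ _ _ (real_hurwitz_correct (1 / 4) e ltac:(lra) He)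
   (real_hurwitz_correct (3 / 4) e ltac:(lra) He)).
assert (Hsub : forall c, (0 < c)%nat ->
  is_lim_seq (fun N => psum (hurwitz_term 1 e) (c * N)) (real_hurwitz 1 e)).
{ intros c Hc. apply (is_lim_seq_subseq (psum (hurwitz_term 1 e))); auto.
  apply eventually_subseq. intros; nia. }
assert (HR := is_lim_seq_minus' _ _ _ _
  (is_lim_seq_scal_l _ (Rpower 4 (1 + e)) _ (Hsub 4%nat ltac:(lia)))
  (is_lim_seq_scal_l _ (Rpower 2 (1 + e)) _ (Hsub 2%nat ltac:(lia)))).
assert (E := is_lim_seq_eq _ _ _ _ (psum_hurwitz_quarters e) HL HR).
rewrite E. simpl. ring.
Qed.

(** [exp 1 <= 3] gives [exp <= 9] on [[0, 2]]; three integrations of this bound give [9/6 = 3/2],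
    rounded up to [2]. *)
Lemma exp_quadratic_bound x : 0 <= x <= 2 -> Rabs (exp x - 1 - x - x ^ 2 / 2) <= 2 * x ^ 3.
Proof.
assert (H9 : forall y, 0 <= y <= 2 -> Rabs (exp y) <= 9).
{ intros y Hy. rewrite Rabs_pos_eq by (left; apply exp_pos).
  apply Rle_trans with (exp (1 + 1)).
  - destruct (Req_dec y (1 + 1)) as [->|]; [lra|]. left. apply exp_increasing. lra.
  - rewrite exp_plus. assert (H := exp_le_3). assert (H' := exp_pos 1). nra. }
assert (H1 : forall y, 0 <= y <= 2 -> Rabs (exp y - 1) <= 9 * y).
{ intros y Hy. rewrite <- exp_0. replace (9 * y) with (9 * (y - 0)) by ring.
  apply lipschitz_bound with exp; [lra| |intros; apply H9; lra].
  intros; auto_derive; auto; ring. }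
assert (H2 : forall y, 0 <= y <= 2 -> Rabs (exp y - 1 - y) <= 9 / 2 * y ^ 2).
{ intros y Hy.
  replace (exp y - 1 - y) with ((exp y - y) - (exp 0 - 0)) by (rewrite exp_0; ring).
  replace (9 / 2 * y ^ 2) with (9 / 2 * y ^ 2 - 9 / 2 * 0 ^ 2) by ring.
  apply (incr_bound (fun y => exp y - y) (fun y => 9 / 2 * y ^ 2) (fun y => exp y - 1) (fun y => 9 * y));
    [lra| | |intros; apply H1; lra]; intros; auto_derive; auto; field. }
intros Hx.
replace (exp x - 1 - x - x ^ 2 / 2) with ((exp x - x - x ^ 2 / 2) - (exp 0 - 0 - 0 ^ 2 / 2))
  by (rewrite exp_0; field).
apply Rle_trans with (3 / 2 * x ^ 3 - 3 / 2 * 0 ^ 3).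
- apply (incr_bound (fun y => exp y - y - y ^ 2 / 2) (fun y => 3 / 2 * y ^ 3)
    (fun y => exp y - 1 - y) (fun y => 9 / 2 * y ^ 2)); [lra| | |intros; apply H2; lra];
    intros; auto_derive; auto; field.
- assert (0 <= x ^ 3) by (apply pow_le; lra). simpl in *. lra.
Qed.

Lemma exp_second_order c : 0 <= c <= 2 ->
  is_lim_seq (fun k => (exp (c * eps k) - 1 - c * eps k) / eps k ^ 2) (c ^ 2 / 2).
Proof.
intros Hc. apply is_lim_seq_sandwich with (fun k => 2 * c ^ 3 * eps k).
- replace (Finite 0) with (Rbar_mult (2 * c ^ 3) 0) by (simpl; f_equal; ring).
  apply (is_lim_seq_scal_l eps _ 0), eps_lim.
- exists O. intros k _. assert (He := eps_pos k).
  assert (H := exp_quadratic_bound (c * eps k) ltac:(nra)).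
  assert (He2 : 0 < eps k ^ 2) by (apply pow_lt; lra).
  replace ((exp (c * eps k) - 1 - c * eps k) / eps k ^ 2 - c ^ 2 / 2) with
    ((exp (c * eps k) - 1 - c * eps k - (c * eps k) ^ 2 / 2) / eps k ^ 2) by (field; lra).
  rewrite Rabs_div by lra. rewrite (Rabs_pos_eq (eps k ^ 2)) by lra.
  apply Rle_div_l; auto. apply Rle_trans with (1 := H). right. ring.
Qed.

(** With [L = ln 2], the factor [E = 4^(1+e) - 2^(1+e)] is [2 + 6 L e + 7 L^2 e^2 + ...]. It
    multiplies a series with a pole [1/e], so its second-order coefficient already enters the
    constants of first order. The zeroth-order relation [G0] comes out first and is then
    subtracted. *)
Lemma stieltjes_quarters_sum :
  g 1%nat (1 / 4) + g 1%nat (3 / 4) = 2 * g 1%nat 1 - 7 * ln 2 ^ 2 - 6 * g 0%nat 1 * ln 2.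
Proof.
set (L := ln 2).
assert (HL : 0 <= L <= 1).
{ unfold L. split; [rewrite <- ln_1; apply ln_le; lra|].
  assert (H := ln_le_sub1 2 ltac:(lra)). lra. }
assert (L4 : ln 4 = 2 * L).
{ unfold L. replace 4 with (2 * 2) by ring. rewrite ln_mult by lra. ring. }
set (E := fun k => Rpower 4 (1 + eps k) - Rpower 2 (1 + eps k)).
set (e2 := fun k => ((E k - 2) / eps k - 6 * L) / eps k).
assert (He2 : is_lim_seq e2 (7 * L ^ 2)).
{ assert (H := is_lim_seq_minus' _ _ _ _
    (is_lim_seq_scal_l _ 4 _ (exp_second_order (2 * L) ltac:(lra)))
    (is_lim_seq_scal_l _ 2 _ (exp_second_order L ltac:(lra)))).
  replace (7 * L ^ 2) with (4 * ((2 * L) ^ 2 / 2) - 2 * (L ^ 2 / 2)) by field.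
  apply is_lim_seq_ext with (2 := H). intros k. unfold e2, E.
  assert (Hk := eps_pos k).
  rewrite !Rpower_plus, !Rpower_1 by lra. unfold Rpower. rewrite L4. fold L.
  rewrite (Rmult_comm (eps k) (2 * L)), (Rmult_comm (eps k) L). field. lra. }
assert (He1 : is_lim_seq (fun k => (E k - 2) / eps k) (6 * L)).
{ apply is_lim_seq_ext with (fun k => 6 * L + eps k * e2 k).
  - intros k. assert (Hk := eps_pos k). unfold e2. field. lra.
  - replace (6 * L) with (6 * L + 0 * (7 * L ^ 2)) at 1 by ring.
    apply is_lim_seq_plus'; [apply is_lim_seq_const|].
    apply is_lim_seq_mult'; auto. apply eps_lim. }
assert (S0 := fun u H => stieltjes_zeroth_order u H).
assert (S1 := fun u H => stieltjes_first_order u H).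
assert (P1 : 0 < 1) by lra. assert (P2 : 0 < 1 / 4) by lra. assert (P3 : 0 < 3 / 4) by lra.
set (h := fun u k => real_hurwitz u (eps k) - / eps k).
assert (R : forall k, h (1 / 4) k + h (3 / 4) k = (E k - 2) / eps k + E k * h 1 k).
{ intros k. assert (Hk := eps_pos k). unfold h.
  assert (Q := real_hurwitz_quarters (eps k) ltac:(lra)). fold (E k) in Q.
  replace (real_hurwitz (1 / 4) (eps k)) with (E k * real_hurwitz 1 (eps k) - real_hurwitz (3 / 4) (eps k))
    by lra.
  field. lra. }
assert (HE : is_lim_seq E 2).
{ apply is_lim_seq_ext with (fun k => 2 + eps k * ((E k - 2) / eps k)).
  - intros k. assert (Hk := eps_pos k). field. lra.
  - replace 2 with (2 + 0 * (6 * L)) at 1 by ring.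
    apply is_lim_seq_plus'; [apply is_lim_seq_const|].
    apply is_lim_seq_mult'; auto. apply eps_lim. }
assert (G0 : g 0%nat (1 / 4) + g 0%nat (3 / 4) = 6 * L + 2 * g 0%nat 1).
{ assert (A := is_lim_seq_plus' _ _ _ _ (S0 _ P2) (S0 _ P3)).
  assert (B := is_lim_seq_plus' _ _ _ _ He1 (is_lim_seq_mult' _ _ _ _ HE (S0 _ P1))).
  assert (Q := is_lim_seq_eq _ _ _ _ R A B). lra. }
assert (A := is_lim_seq_plus' _ _ _ _ (S1 _ P2) (S1 _ P3)).
assert (B := is_lim_seq_plus' _ _ _ _ (is_lim_seq_plus' _ _ _ _ He2
    (is_lim_seq_mult' _ _ _ _ He1 (S0 _ P1))) (is_lim_seq_scal_l _ 2 _ (S1 _ P1))).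
assert (Q := fun H => is_lim_seq_eq _ _ _ _ H A B). simpl in Q.
enough (- g 1%nat (1 / 4) + - g 1%nat (3 / 4) =
  7 * L ^ 2 + 6 * L * g 0%nat 1 + 2 * - g 1%nat 1) by lra.
apply Q. intros k. assert (Hk := eps_pos k). specialize (R k). unfold h in R.
transitivity ((real_hurwitz (1 / 4) (eps k) - / eps k + (real_hurwitz (3 / 4) (eps k) - / eps k)
   - (g 0%nat (1 / 4) + g 0%nat (3 / 4))) / eps k).
- field. lra.
- rewrite R, G0. unfold e2. field. lra.
Qed.

(** * The zeroth constant at [1] is Euler's constant *)

(** The middle term is the integral of [t^(-1-e)] over [[x, y]], the outer ones are the lower and
    upper rectangles. *)
Lemma Rpower_le_derive (x y e : R) : 0 < x <= y -> 0 < e ->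
  Rpower y (- (1 + e)) * (y - x) <= (Rpower x (- e) - Rpower y (- e)) / e <=
  Rpower x (- (1 + e)) * (y - x).
Proof.
intros Hxy He.
destruct (MVT_gen (fun t => Rpower t (- e)) x y (fun t => - e * Rpower t (- (1 + e)))) as [c [Hc E]].
- rewrite Rmin_left, Rmax_right by lra. intros t Ht.
  apply is_derive_Reals. replace (- (1 + e)) with (- e - 1) by ring.
  apply derivable_pt_lim_power. lra.
- rewrite Rmin_left, Rmax_right by lra. intros t Ht.
  apply derivable_continuous_pt. eexists. apply derivable_pt_lim_power. lra.
- rewrite Rmin_left, Rmax_right in Hc by lra.
  replace ((Rpower x (- e) - Rpower y (- e)) / e) with (Rpower c (- (1 + e)) * (y - x))
    by (apply Rmult_eq_reg_l with e; [field_simplify; lra|lra]).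
  assert (M : forall s t, 0 < s <= t -> Rpower t (- (1 + e)) <= Rpower s (- (1 + e))).
  { intros s t Hst. rewrite !Rpower_Ropp. apply Rinv_le_contravar; [apply exp_pos|].
    apply Rle_Rpower_l; lra. }
  split; apply Rmult_le_compat_r; try lra; apply M; lra.
Qed.

Lemma zeta_tail_bounds e M j : 0 < e ->
  let I n := Rpower (INR (S n)) (- e) / e in
  I M - I (M + j)%nat <= psum (hurwitz_term 1 e) (M + j) - psum (hurwitz_term 1 e) M
   <= I M - I (M + j)%nat + (hurwitz_term 1 e M - hurwitz_term 1 e (M + j)).
Proof.
intros He I. induction j.
- rewrite Nat.add_0_r. lra.
- replace (M + S j)%nat with (S (M + j)) by lia. cbn [psum]. set (n := (M + j)%nat) in *.
  assert (Hn := pos_INR n).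
  assert (H := Rpower_le_derive (INR n + 1) (INR (S n) + 1) e).
  rewrite S_INR in H. specialize (H ltac:(lra) He).
  replace (INR n + 1 + 1 - (INR n + 1)) with 1 in H by ring.
  rewrite !Rmult_1_r in H.
  assert (E : I n - I (S n) = (Rpower (INR n + 1) (- e) - Rpower (INR n + 1 + 1) (- e)) / e).
  { unfold I. rewrite !S_INR. field. lra. }
  unfold hurwitz_term in *. rewrite S_INR. lra.
Qed.

Lemma Rpower_neg_lim e : 0 < e -> is_lim_seq (fun n => Rpower (INR (S n)) (- e) / e) 0.
Proof.
intros He. replace (Finite 0) with (Rbar_mult 0 (/ e)) by (simpl; f_equal; ring).
apply (is_lim_seq_scal_r _ (/ e) 0).
apply (is_lim_comp_seq exp (fun n => - e * ln (INR (S n))) m_infty 0).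
- apply is_lim_exp_m.
- exists O. intros n _. discriminate.
- replace m_infty with (Rbar_mult (- e) p_infty).
  + apply is_lim_seq_scal_l.
    apply (is_lim_comp_seq ln (fun n => INR (S n)) p_infty p_infty).
    * apply is_lim_ln_p.
    * exists O. intros n _. discriminate.
    * apply -> (is_lim_seq_incr_1 INR). apply is_lim_seq_INR.
  + simpl. destruct (Rle_dec 0 (- e)); [exfalso; lra|reflexivity].
Qed.

(** Integral comparison for the tail. The error [1 / (M + 1)] does not depend on [e], so [e] may
    tend to [0] with [M] fixed. *)
Lemma real_zeta_bounds e M : 0 < e ->
  0 <= real_hurwitz 1 e - psum (hurwitz_term 1 e) M - Rpower (INR (S M)) (- e) / e <= / INR (S M).
Proof.
intros He. set (I := fun n => Rpower (INR (S n)) (- e) / e).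
assert (HI := Rpower_neg_lim e He). fold I in HI.
assert (HZ := real_hurwitz_correct 1 e ltac:(lra) He).
assert (HL : is_lim_seq (fun N => psum (hurwitz_term 1 e) N - psum (hurwitz_term 1 e) M - I M + I N)
   (real_hurwitz 1 e - psum (hurwitz_term 1 e) M - I M + 0)).
{ apply is_lim_seq_plus'; auto.
  apply is_lim_seq_minus'; [apply is_lim_seq_minus'|]; auto; apply is_lim_seq_const. }
rewrite Rplus_0_r in HL.
assert (HB : forall N, (M <= N)%nat ->
  0 <= psum (hurwitz_term 1 e) N - psum (hurwitz_term 1 e) M - I M + I N <= / INR (S M)).
{ intros N HN. assert (H := zeta_tail_bounds e M (N - M) He). simpl in H.
  replace (M + (N - M))%nat with N in H by lia.
  change (Rpower (match M with 0%nat => 1 | S _ => INR M + 1 end) (- e) / e) with (I M) in H.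
  change (Rpower (match N with 0%nat => 1 | S _ => INR N + 1 end) (- e) / e) with (I N) in H.
  assert (0 < hurwitz_term 1 e N) by apply exp_pos.
  assert (hurwitz_term 1 e M <= / INR (S M)).
  { unfold hurwitz_term. rewrite Rpower_Ropp, S_INR. assert (HM := pos_INR M).
    apply Rinv_le_contravar; [lra|].
    rewrite <- (Rpower_1 (INR M + 1)) at 1 by lra.
    apply Rle_Rpower; lra. }
  lra. }
split.
- apply (is_lim_seq_le_loc (fun _ => 0) _ 0 _) with (3 := HL).
  + exists M. intros N HN. now apply HB.
  + apply is_lim_seq_const.
- apply (is_lim_seq_le_loc _ (fun _ => / INR (S M)) _ (/ INR (S M))) with (2 := HL).
  + exists M. intros N HN. now apply HB.
  + apply is_lim_seq_const.
Qed.

Lemma is_lim_seq_psum (f : nat -> nat -> R) (l : nat -> R) N :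
  (forall n, is_lim_seq (f n) (l n)) ->
  is_lim_seq (fun k => psum (fun n => f n k) N) (psum l N).
Proof.
intros H. induction N; simpl; [apply is_lim_seq_const|].
now apply is_lim_seq_plus'.
Qed.

Lemma is_derive_Rpower_exponent x c : 0 < x ->
  forall t, is_derive (fun t => Rpower x (- (c + t))) t (- (Rpower x (- (c + t)) * ln x)).
Proof.
intros Hx t. unfold Rpower. auto_derive; auto. ring.
Qed.

Lemma hurwitz_term_eps_lim u n : 0 < u ->
  is_lim_seq (fun k => hurwitz_term u (eps k) n) (/ (INR n + u)).
Proof.
intros Hu. assert (Hn := pos_INR n). assert (Hx : 0 < INR n + u) by lra.
assert (H : is_lim_seq (fun k => Rpower (INR n + u) (- (1 + eps k))) (Rpower (INR n + u) (- (1 + 0)))).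
{ apply (is_lim_seq_continuous (fun t => Rpower (INR n + u) (- (1 + t)))); [|apply eps_lim].
  apply continuity_pt_filterlim, (ex_derive_continuous (fun t => Rpower (INR n + u) (- (1 + t)))).
  eexists. now apply is_derive_Rpower_exponent. }
replace (/ (INR n + u)) with (Rpower (INR n + u) (- (1 + 0))); auto.
now rewrite Rplus_0_r, Rpower_Ropp, Rpower_1.
Qed.

(** After removing the pole, the integral tail contributes [((M + 1)^(-e) - 1) / e], which tends to
    [- ln (M + 1)]. This encloses [g 0 1] within [1 / (M + 1)] of the sequence defining
    [euler_gamma]. *)
Lemma stieltjes_0_1 : g 0%nat 1 = euler_gamma.
Proof.
assert (HM : forall M, harmonic (S M) - ln (INR (S M)) - / INR (S M) <= g 0%nat 1
    <= harmonic (S M) - ln (INR (S M))).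
{ intros M.
  assert (HP : 0 < INR (S M)) by (apply lt_0_INR; lia).
  (* The zeros match [is_derive_Rpower_exponent] at [c = 0], so that the quotient is literally a
     difference quotient at [0]. *)
  set (u := fun k => psum (hurwitz_term 1 (eps k)) M + (Rpower (INR (S M)) (- (0 + eps k)) - Rpower (INR (S M)) (- (0 + 0))) / eps k).
  assert (Hu : is_lim_seq u (harmonic (S M) - / INR (S M) - ln (INR (S M)))).
  { unfold harmonic. cbn [psum].
    replace (psum (fun k => / INR (S k)) M + / INR (S M) - / INR (S M) - ln (INR (S M)))
      with (psum (fun k => / (INR k + 1)) M + - (Rpower (INR (S M)) (- (0 + 0)) * ln (INR (S M)))).
    - apply is_lim_seq_plus'.
      + apply (is_lim_seq_psum (fun n k => hurwitz_term 1 (eps k) n)).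
        intros n. apply hurwitz_term_eps_lim. lra.
      + apply (derive_eps_lim (fun t => Rpower (INR (S M)) (- (0 + t)))).
        now apply is_derive_Rpower_exponent.
    - rewrite Rplus_0_r, Ropp_0, Rpower_O by auto.
      rewrite (psum_ext _ (fun k => / INR (S k))) by (intros; now rewrite S_INR). ring. }
  assert (Hh := stieltjes_zeroth_order 1 Rlt_0_1).
  assert (B : forall k, u k <= real_hurwitz 1 (eps k) - / eps k <= u k + / INR (S M)).
  { intros k. assert (He := eps_pos k).
    assert (H := real_zeta_bounds (eps k) M ltac:(lra)).
    unfold u. rewrite !Rplus_0_l, Ropp_0, Rpower_O by auto.
    replace ((Rpower (INR (S M)) (- eps k) - 1) / eps k) with
      (Rpower (INR (S M)) (- eps k) / eps k - / eps k) by (field; lra).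
    lra. }
  split.
  - apply (is_lim_seq_le u (fun k => real_hurwitz 1 (eps k) - / eps k)
      (harmonic (S M) - ln (INR (S M)) - / INR (S M)) (g 0%nat 1)); auto.
    + intros; apply B.
    + replace (harmonic (S M) - ln (INR (S M)) - / INR (S M)) with
       (harmonic (S M) - / INR (S M) - ln (INR (S M))) by ring. exact Hu.
  - apply (is_lim_seq_le (fun k => real_hurwitz 1 (eps k) - / eps k) (fun k => u k + / INR (S M))
      (g 0%nat 1) (harmonic (S M) - ln (INR (S M)))); auto.
    + intros; apply B.
    + replace (harmonic (S M) - ln (INR (S M))) with
       (harmonic (S M) - / INR (S M) - ln (INR (S M)) + / INR (S M)) by ring.
      apply is_lim_seq_plus'; auto. apply is_lim_seq_const. }
assert (HE := euler_gamma_lim). apply is_lim_seq_incr_1 in HE.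
assert (HI := eps_lim).
assert (Hc : is_lim_seq (fun M => harmonic (S M) - ln (INR (S M))) (g 0%nat 1)).
{ apply is_lim_seq_sandwich with (1 := HI). exists O. intros M _.
  specialize (HM M). unfold eps. apply Rabs_le. lra. }
exact (is_lim_seq_eq _ _ _ _ (fun _ => eq_refl) Hc HE).
Qed.

(** * The difference of the constants at [1/4] and [3/4] *)

Definition log_power (t x : R) : R := Rpower x (- (1 + t)) * ln x.

(** Once [ln x >= 1], the logarithm grows more slowly than the power decays; [3] stands in for [e]
    and is why cutoffs start at [N = 3]. *)
Lemma log_power_decr t x y : 0 <= t -> 3 <= x <= y -> 0 <= log_power t y <= log_power t x.
Proof.
intros Ht Hxy. unfold log_power, Rpower.
assert (H1 : 1 <= ln x).
{ rewrite <- (ln_exp 1). apply ln_le; [apply exp_pos|]. assert (H := exp_le_3). lra. }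
assert (H2 : ln x <= ln y) by (apply ln_le; lra).
set (l := ln x) in *. set (d := ln y - l). replace (ln y) with (l + d) by (unfold d; ring).
assert (Hd : 0 <= d) by (unfold d; lra).
split; [apply Rmult_le_pos; [left; apply exp_pos|lra]|].
replace (- (1 + t) * (l + d)) with (- (1 + t) * l + - ((1 + t) * d)) by ring.
rewrite exp_plus, Rmult_assoc. apply Rmult_le_compat_l; [left; apply exp_pos|].
rewrite exp_Ropp, Rmult_comm. apply Rle_div_l; [apply exp_pos|].
assert (H := exp_ineq1_le ((1 + t) * d)).
apply Rle_trans with (l * (1 + (1 + t) * d)); [|apply Rmult_le_compat_l; lra].
assert (0 <= t * d) by (apply Rmult_le_pos; lra). nra.
Qed.

Definition log_power_diff_sum (t : R) (N : nat) : R :=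
  psum (fun n => log_power t (INR n + 1 / 4) - log_power t (INR n + 3 / 4)) N.

(** An alternating series bound: the points [n + 1/4 < n + 3/4 < n + 5/4] interlace, so monotonicity
    makes the differences telescope. *)
Lemma log_power_tail t N j : 0 <= t -> (3 <= N)%nat ->
  0 <= log_power_diff_sum t (N + j) - log_power_diff_sum t N
    <= log_power t (INR N + 1 / 4) - log_power t (INR (N + j) + 1 / 4).
Proof.
intros Ht HN. unfold log_power_diff_sum. induction j.
- rewrite Nat.add_0_r. lra.
- replace (N + S j)%nat with (S (N + j)) by lia. cbn [psum]. set (n := (N + j)%nat) in *.
  assert (Hn : 3 <= INR n).
  { replace 3 with (INR 3) by (simpl; ring). apply le_INR. lia. }
  rewrite S_INR.
  assert (H1 := log_power_decr t (INR n + 1 / 4) (INR n + 3 / 4) Ht ltac:(lra)).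
  assert (H2 := log_power_decr t (INR n + 3 / 4) (INR n + 1 + 1 / 4) Ht ltac:(lra)).
  lra.
Qed.

Definition hurwitz_diff_sum (N : nat) (e : R) : R :=
  psum (fun n => hurwitz_term (1 / 4) e n - hurwitz_term (3 / 4) e n) N.

Lemma is_derive_hurwitz_diff_sum N t :
  is_derive (hurwitz_diff_sum N) t (- log_power_diff_sum t N).
Proof.
replace (- log_power_diff_sum t N) with
  (psum (fun n => - log_power t (INR n + 1 / 4) - - log_power t (INR n + 3 / 4)) N).
- apply (is_derive_psum (fun n e => hurwitz_term (1 / 4) e n - hurwitz_term (3 / 4) e n)
    (fun n t => - log_power t (INR n + 1 / 4) - - log_power t (INR n + 3 / 4))).
  intros n. assert (Hn := pos_INR n).
  apply (is_derive_minus (fun e => hurwitz_term (1 / 4) e n) (fun e => hurwitz_term (3 / 4) e n));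
    apply is_derive_Rpower_exponent; lra.
- unfold log_power_diff_sum. replace (- psum _ N) with (-1 * psum
     (fun n => log_power t (INR n + 1 / 4) - log_power t (INR n + 3 / 4)) N) by ring.
  rewrite <- psum_scal. apply psum_ext. intros; ring.
Qed.

(* The mean value theorem in the exponent is applied to the whole block of terms at once, so that
   its derivative telescopes. *)
Lemma hurwitz_diff_tail e N M : 0 <= e -> (3 <= N <= M)%nat ->
  Rabs ((hurwitz_diff_sum M e - hurwitz_diff_sum N e) -
        (hurwitz_diff_sum M 0 - hurwitz_diff_sum N 0)) <= log_power 0 (INR N + 1 / 4) * e.
Proof.
intros He HNM. replace e with (e - 0) at 3 by ring.
apply (lipschitz_bound (fun t => hurwitz_diff_sum M t - hurwitz_diff_sum N t)
   (fun t => - log_power_diff_sum t M - - log_power_diff_sum t N)); auto.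
- intros t _. apply (is_derive_minus (hurwitz_diff_sum M) (hurwitz_diff_sum N));
    apply is_derive_hurwitz_diff_sum.
- intros t Ht.
  assert (H := log_power_tail t N (M - N) ltac:(lra) ltac:(lia)).
  replace (N + (M - N))%nat with M in H by lia.
  assert (HN : 3 <= INR N).
  { replace 3 with (INR 3) by (simpl; ring). apply le_INR. lia. }
  assert (HM : 3 <= INR M).
  { replace 3 with (INR 3) by (simpl; ring). apply le_INR. lia. }
  assert (H1 := log_power_decr t (INR M + 1 / 4) (INR M + 1 / 4) ltac:(lra) ltac:(lra)).
  assert (H2 : log_power t (INR N + 1 / 4) <= log_power 0 (INR N + 1 / 4)).
  { unfold log_power. apply Rmult_le_compat_r.
    - rewrite <- ln_1. apply ln_le; lra.
    - apply Rle_Rpower; lra. }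
  apply Rabs_le. lra.
Qed.

Lemma hurwitz_diff_sum_0 N : hurwitz_diff_sum N 0 = 4 * leibniz (2 * N).
Proof.
unfold hurwitz_diff_sum, leibniz. induction N; [simpl; ring|].
replace (2 * S N)%nat with (S (S (2 * N))) by lia. cbn [psum]. rewrite IHN.
assert (Hn := pos_INR N).
unfold hurwitz_term. rewrite !Rplus_0_r, !Rpower_Ropp, !Rpower_1 by lra.
rewrite <- tech_pow_Rmult, pow_1_even, S_INR, mult_INR. simpl INR. field. lra.
Qed.

(** Each [n] contributes two consecutive terms of the alternating series, and
    [ln (n + 1/4) = ln (4n + 1) - 2 ln 2], likewise at [3/4], produces the [leibniz] term. *)
Lemma log_power_diff_sum_0 N :
  log_power_diff_sum 0 N = 4 * alt_log_sum (2 * N) - 8 * ln 2 * leibniz (2 * N).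
Proof.
unfold log_power_diff_sum, leibniz, alt_log_sum. induction N; [simpl; ring|].
replace (2 * S N)%nat with (S (S (2 * N))) by lia. cbn [psum]. rewrite IHN.
assert (Hn := pos_INR N).
unfold log_power. rewrite !Rplus_0_r, !Rpower_Ropp, !Rpower_1 by lra.
rewrite <- !tech_pow_Rmult, !pow_1_even, !S_INR, !mult_INR. simpl INR.
replace (2 * ((1 + 1) * INR N) + 1) with (2 * 2 * (INR N + 1 / 4)) by field.
replace (2 * ((1 + 1) * INR N + 1) + 1) with (2 * 2 * (INR N + 3 / 4)) by field.
rewrite !ln_mult by lra. field. lra.
Qed.

Lemma log_power_0_lim : is_lim_seq (fun N => log_power 0 (INR N + 1 / 4)) 0.
Proof.
apply is_lim_seq_ext with (fun N => ln (INR N + 1 / 4) / (INR N + 1 / 4)).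
- intros N. assert (H := pos_INR N). unfold log_power.
  rewrite Rplus_0_r, Rpower_Ropp, Rpower_1 by lra. unfold Rdiv. ring.
- apply (is_lim_comp_seq (fun y => ln y / y) (fun N => INR N + 1 / 4) p_infty 0).
  + apply is_lim_div_ln_p.
  + exists O. intros n _. discriminate.
  + replace p_infty with (Rbar_plus p_infty (1 / 4)) by reflexivity.
    apply is_lim_seq_plus with p_infty (1 / 4); [apply is_lim_seq_INR|apply is_lim_seq_const|reflexivity].
Qed.

Lemma is_lim_seq_double (u : nat -> R) l :
  is_lim_seq u l -> is_lim_seq (fun n => u (2 * n)%nat) l.
Proof.
intros H. apply (is_lim_seq_subseq u); auto. apply eventually_subseq. intros; lia.
Qed.

Lemma real_hurwitz_diff_estimate e N : 0 < e -> (3 <= N)%nat ->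
  Rabs ((real_hurwitz (1 / 4) e - real_hurwitz (3 / 4) e - PI) -
        (hurwitz_diff_sum N e - hurwitz_diff_sum N 0)) <= log_power 0 (INR N + 1 / 4) * e.
Proof.
intros He HN.
assert (H4 := real_hurwitz_correct (1 / 4) e ltac:(lra) He).
assert (H34 := real_hurwitz_correct (3 / 4) e ltac:(lra) He).
assert (H0 : is_lim_seq (fun M => hurwitz_diff_sum M 0) PI).
{ apply is_lim_seq_ext with (fun M => 4 * leibniz (2 * M)).
  - intros M. now rewrite hurwitz_diff_sum_0.
  - replace PI with (4 * (PI / 4)) by field.
    apply (is_lim_seq_scal_l _ 4 (PI / 4)). apply (is_lim_seq_double leibniz), leibniz_lim. }
assert (He' : is_lim_seq (fun M => hurwitz_diff_sum M e) (real_hurwitz (1 / 4) e - real_hurwitz (3 / 4) e)).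
{ apply is_lim_seq_ext with (fun M => psum (hurwitz_term (1 / 4) e) M - psum (hurwitz_term (3 / 4) e) M).
  - intros M. symmetry. apply (psum_minus (hurwitz_term (1 / 4) e)).
  - now apply is_lim_seq_minus'. }
apply (is_lim_seq_le_loc (fun M => Rabs ((hurwitz_diff_sum M e - hurwitz_diff_sum N e) -
        (hurwitz_diff_sum M 0 - hurwitz_diff_sum N 0))) (fun _ => log_power 0 (INR N + 1 / 4) * e)
   (Rabs ((real_hurwitz (1 / 4) e - real_hurwitz (3 / 4) e - PI) -
        (hurwitz_diff_sum N e - hurwitz_diff_sum N 0))) (log_power 0 (INR N + 1 / 4) * e)).
- exists N. intros M HM. apply hurwitz_diff_tail; [lra|lia].
- replace (real_hurwitz (1 / 4) e - real_hurwitz (3 / 4) e - PI -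
        (hurwitz_diff_sum N e - hurwitz_diff_sum N 0)) with
   (real_hurwitz (1 / 4) e - real_hurwitz (3 / 4) e - hurwitz_diff_sum N e -
        (PI - hurwitz_diff_sum N 0)) by ring.
  apply (is_lim_seq_abs _ (Finite _)).
  repeat apply is_lim_seq_minus'; auto; apply is_lim_seq_const.
- apply is_lim_seq_const.
Qed.

(** The difference quotient in [e] of the full series stays within [log_power 0 (N + 1/4)] of that
    of its [N]-th partial sum, for every [e]. Letting [e] tend to [0] for fixed [N] transfers this
    bound to the derivatives, and then [N] grows. *)
Lemma stieltjes_quarters_diff :
  is_lim_seq (log_power_diff_sum 0) (g 1%nat (1 / 4) - g 1%nat (3 / 4)).
Proof.
assert (P2 : 0 < 1 / 4) by lra. assert (P3 : 0 < 3 / 4) by lra.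
set (Z := fun k => real_hurwitz (1 / 4) (eps k) - real_hurwitz (3 / 4) (eps k)).
assert (HQ : forall N, is_lim_seq (fun k => (hurwitz_diff_sum N (eps k) - hurwitz_diff_sum N 0) / eps k)
    (- log_power_diff_sum 0 N)).
{ intros N. apply derive_eps_lim, is_derive_hurwitz_diff_sum. }
assert (HB : forall N k, (3 <= N)%nat ->
  Rabs ((Z k - PI) / eps k - (hurwitz_diff_sum N (eps k) - hurwitz_diff_sum N 0) / eps k)
    <= log_power 0 (INR N + 1 / 4)).
{ intros N k HN. assert (He := eps_pos k).
  assert (H := real_hurwitz_diff_estimate (eps k) N ltac:(lra) HN). fold (Z k) in H.
  replace ((Z k - PI) / eps k - (hurwitz_diff_sum N (eps k) - hurwitz_diff_sum N 0) / eps k) with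
    ((Z k - PI - (hurwitz_diff_sum N (eps k) - hurwitz_diff_sum N 0)) / eps k) by (field; lra).
  rewrite Rabs_div by lra. rewrite (Rabs_pos_eq (eps k)) by lra. apply Rle_div_l; lra. }
(* The cutoff [3] already shows that the quotients [(Z k - PI) / eps k] are bounded, which suffices
   for [Z] to converge to [PI] and identifies the difference of the zeroth constants. *)
assert (HZ : is_lim_seq Z PI).
{ set (c := log_power 0 (INR 3 + 1 / 4)).
  apply is_lim_seq_sandwich with (fun k => eps k * (Rabs ((hurwitz_diff_sum 3 (eps k) - hurwitz_diff_sum 3 0) / eps k) + c)).
  - replace (Finite 0) with (Finite (0 * (Rabs (- log_power_diff_sum 0 3) + c))) by (f_equal; ring).
    apply is_lim_seq_mult'; [apply eps_lim|].
    apply is_lim_seq_plus'; [|apply is_lim_seq_const].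
    apply (is_lim_seq_abs _ (Finite _)), HQ.
  - exists O. intros k _. assert (He := eps_pos k). specialize (HB 3%nat k ltac:(lia)).
    fold c in HB. set (q := (hurwitz_diff_sum 3 (eps k) - hurwitz_diff_sum 3 0) / eps k) in *.
    replace (Z k - PI) with (eps k * (q + ((Z k - PI) / eps k - q))) by (field; lra).
    rewrite Rabs_mult, (Rabs_pos_eq (eps k)) by lra.
    apply Rmult_le_compat_l; [lra|]. apply Rle_trans with (1 := Rabs_triang _ _). lra. }
assert (G0 : g 0%nat (1 / 4) - g 0%nat (3 / 4) = PI).
{ assert (A := is_lim_seq_minus' _ _ _ _ (stieltjes_zeroth_order _ P2) (stieltjes_zeroth_order _ P3)).
  apply (is_lim_seq_eq _ Z _ _) with (2 := A) (3 := HZ). intros k. unfold Z. ring. }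
assert (HD : is_lim_seq (fun k => (Z k - PI) / eps k) (- (g 1%nat (1 / 4) - g 1%nat (3 / 4)))).
{ assert (A := is_lim_seq_minus' _ _ _ _ (stieltjes_first_order _ P2) (stieltjes_first_order _ P3)).
  replace (- (g 1%nat (1 / 4) - g 1%nat (3 / 4))) with (- g 1%nat (1 / 4) - - g 1%nat (3 / 4)) by ring.
  apply is_lim_seq_ext with (2 := A). intros k. assert (He := eps_pos k).
  rewrite <- G0. unfold Z. field. lra. }
apply is_lim_seq_sandwich with (1 := log_power_0_lim).
exists 3%nat. intros N HN.
replace (log_power_diff_sum 0 N - (g 1%nat (1 / 4) - g 1%nat (3 / 4))) with
  (- (g 1%nat (1 / 4) - g 1%nat (3 / 4)) - - log_power_diff_sum 0 N) by ring.
apply (is_lim_seq_le (fun k => Rabs ((Z k - PI) / eps k - (hurwitz_diff_sum N (eps k) - hurwitz_diff_sum N 0) / eps k))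
  (fun _ => log_power 0 (INR N + 1 / 4)) (Rabs (- (g 1%nat (1 / 4) - g 1%nat (3 / 4)) - - log_power_diff_sum 0 N))
  (log_power 0 (INR N + 1 / 4))).
- intros k. now apply HB.
- apply (is_lim_seq_abs _ (Finite _)). now apply is_lim_seq_minus'.
- apply is_lim_seq_const.
Qed.

Lemma stieltjes_quarters_diff_value :
  g 1%nat (1 / 4) - g 1%nat (3 / 4) =
  PI * (4 * ln (Gamma (1 / 4)) - 3 * ln PI - 4 * ln 2 - euler_gamma).
Proof.
assert (A := stieltjes_quarters_diff).
assert (B := is_lim_seq_minus' _ _ _ _
  (is_lim_seq_scal_l _ 4 _ (is_lim_seq_double _ _ alt_log_sum_value))
  (is_lim_seq_scal_l _ (8 * ln 2) _ (is_lim_seq_double _ _ leibniz_lim))).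
rewrite (is_lim_seq_eq _ _ _ _ log_power_diff_sum_0 A B). field.
Qed.

End Stieltjes.

Theorem mainTheorem4 :
  forall (zeta : C -> R -> C) (g : nat -> R -> R),
    is_hurwitz_zeta zeta ->
    is_stieltjes zeta g ->
    g 1%nat (3 / 4) =
      1 / 2 * (2 * g 1%nat 1 - 7 * ln 2 ^ 2 - 6 * euler_gamma * ln 2)
      + 1 / 2 * PI *
        (euler_gamma + 4 * ln 2 + 3 * ln PI - 4 * ln (Gamma (1 / 4))).
Proof.
intros zeta g Hzeta Hg.
assert (S := stieltjes_quarters_sum zeta g Hzeta Hg).
assert (D := stieltjes_quarters_diff_value zeta g Hzeta Hg).
rewrite (stieltjes_0_1 zeta g Hzeta Hg) in S.
lra.
Qed.
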